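(* Let $k$ be a positive integer with $k\equiv1\pmod{q-1}$ and set $$\lambda_k:=-\frac{L(\chi_t,k)}{\widetilde\pi^k}+\frac{1}{\omega(t)}\sum_{l=0}^{\lfloor\log_q(k-1)\rfloor}\frac{\zeta(k-q^l)+E^{(k-q^l)}(z)}{\widetilde\pi^{k-q^l}(\theta^{q^l}-t)D_l}$$ (the sum being empty for $k=1$). Then for all $z\in\Omega$ with $|z|_\Im$ sufficiently large, $$\widetilde\pi^{-k}\mathcal E_k(z)=\binom{0}{1}\lambda_k+\sum_{a\in A_+}\binom{-a(t)}{\chi_t(az)}G_k(u(az)).$$
   Context: Notation: $q$ a prime power, $A=\mathbb F_q[\theta]$, $A_+$ the monic elements, $K_\infty=\mathbb F_q((1/\theta))$, $\mathbb C_\infty$ the completion of an algebraic closure of $K_\infty$, $\Omega=\mathbb C_\infty\setminus K_\infty$, $|z|_\Im=\inf_{\kappa\in K_\infty}|z-\kappa|$. $\mathbb T$ is the Tate algebra of series $\sum f_it^i$, $f_i\in\mathbb C_\infty$, $f_i\to0$. $a(t)$ is the image of $a\in A$ under $\theta\mapsto t$. $\widetilde\pi$ is the Carlitz period and $u(z)=\widetilde\pi^{-1}\sum_{a\in A}(z-a)^{-1}$. $D_0=1$, $D_j=\prod_{i=0}^{j-1}(\theta^{q^j}-\theta^{q^i})$; $\omega(t)=\sum_{j\ge0}\frac{\widetilde\pi^{q^j}}{(\theta^{q^j}-t)D_j}$; for $z\in\mathbb C_\infty$, $\chi_t(z)=\omega(t)^{-1}\sum_{j\ge0}\frac{\widetilde\pi^{q^j}z^{q^j}}{(\theta^{q^j}-t)D_j}$.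 $\mathcal E_k(z)=\sum_{(a,b)\in A^2\setminus\{(0,0)\}}(az+b)^{-k}\binom{a(t)}{b(t)}$, $L(\chi_t,k)=\sum_{a\in A_+}a(t)a^{-k}$, $\zeta(n)=\sum_{a\in A_+}a^{-n}$ (Carlitz zeta value), $E^{(n)}(z)=\sum_{(a,b)\in A^2\setminus\{(0,0)\}}(az+b)^{-n}$ (Goss' Eisenstein series). $G_k\in\mathbb C_\infty[X]$ is the $k$-th Goss polynomial of the lattice $A$, characterized by $G_k(u(z))=\widetilde\pi^{-k}\sum_{a\in A}(z-a)^{-k}$ (so $G_1(X)=X$). *)

(* Defs.v *)
From HB Require Import structures.
From mathcomp Require Import all_boot all_order all_algebra.
From mathcomp Require Import reals.
From Stdlib Require Import ClassicalEpsilon.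
Set Implicit Arguments. Unset Strict Implicit. Unset Printing Implicit Defensive.
Import Order.TTheory GRing.Theory Num.Theory.
Local Open Scope ring_scope.

(* Setting:
   - R : realType, values of the absolute value;
   - C : an algebraically closed field playing the role of C_infty,
     with absolute value nrm : C -> R;
   - F : the finite field F_q, q = #|F|, embedded in C by iota;
   - theta : C, the image of the variable theta of A = F_q[theta].
   A = {poly F}; a : A is sent to (map_poly iota a).[theta] in C.
   Elements of the Tate algebra T are represented by their coefficient
   sequences nat -> C (coefficient of t^i). *)

Section Carlitz.
Variables (R : realType) (C : closedFieldType) (F : finFieldType).
Variable iota : {rmorphism F -> C}.
Variable nrm : C -> R.
Variable theta : C.

Definition qq : nat := #|F|.

Definition embA (a : {poly F}) : C := (map_poly iota a).[theta].
Definition tateA (a : {poly F}) : nat -> C := fun i => iota a`_i.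

Definition cvgC (u : nat -> C) (l : C) : Prop :=
  forall e : R, 0 < e -> exists N, forall n, (N <= n)%N -> nrm (u n - l) < e.
Definition cauchyC (u : nat -> C) : Prop :=
  forall e : R, 0 < e -> exists N, forall n m, (N <= n)%N -> (N <= m)%N ->
    nrm (u n - u m) < e.

(* K_infty = F_q((1/theta)) inside C: elements theta^N * sum_{i>=0} c_i theta^-i *)
Definition Kinf (x : C) : Prop :=
  exists (N : nat) (c : nat -> F),
    cvgC (fun n => \sum_(i < n) iota (c i) * theta ^- i) (x / theta ^+ N).

Definition Omega (z : C) : Prop := ~ Kinf z.

(* C is (a model of) C_infty: a complete, algebraically closed,
   non-archimedean valued field with |theta| = q, in which the
   algebraic closure of K_infty is dense. *)
Definition is_Cinfty : Prop :=
  (forall x, 0 <= nrm x) /\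
  (forall x, nrm x = 0 <-> x = 0) /\
  (forall x y, nrm (x * y) = nrm x * nrm y) /\
  (forall x y, nrm (x + y) <= Num.max (nrm x) (nrm y)) /\
  nrm theta = (qq%:R : R) /\
  (forall u, cauchyC u -> exists l, cvgC u l) /\
  (forall x (e : R), 0 < e -> exists y,
      (exists p : {poly C}, [/\ p != 0, (forall i, Kinf p`_i) & root p y])
      /\ nrm (x - y) < e).

(* limit in C (well defined when the sequence converges) *)
Definition Clim (u : nat -> C) : C := epsilon (inhabits 0) (fun l => cvgC u l).

(* convergence and limits in the Tate algebra T (Gauss norm) *)
Definition cvgT (u : nat -> nat -> C) (l : nat -> C) : Prop :=
  forall e : R, 0 < e -> exists N, forall n, (N <= n)%N ->
    forall i, nrm (u n i - l i) < e.
Definition Tlim (u : nat -> nat -> C) : nat -> C :=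
  epsilon (inhabits (fun _ => 0)) (fun l => cvgT u l).

Definition Tone : nat -> C := fun i => if i == 0%N then 1 else 0.
Definition Tmul (f g : nat -> C) : nat -> C :=
  fun i => \sum_(j < i.+1) f j * g (i - j)%N.
(* inverse in T (well defined for units) *)
Definition Tinv (f : nat -> C) : nat -> C :=
  epsilon (inhabits (fun _ => 0)) (fun g => Tmul f g = Tone).

(* 1/(c - t) = sum_i t^i / c^(i+1) *)
Definition inv_ct (c : C) : nat -> C := fun i => c ^- i.+1.

Definition polyN n (f : {ffun 'I_n -> F}) : {poly F} := Poly (fgraph f).
Definition monicN d (f : {ffun 'I_d -> F}) : {poly F} := 'X^d + Poly (fgraph f).

(* the Carlitz period: pit = (-theta)^(q/(q-1)) prod_{i>=1} (1 - theta^(1-q^i))^-1,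
   for some choice r of a (q-1)-th root of -theta *)
Definition is_carlitz_period (pit : C) : Prop :=
  exists r : C, r ^+ (qq - 1) = - theta /\
    cvgC (fun n => r ^+ qq *
                   \prod_(1 <= i < n) (1 - theta / theta ^+ (qq ^ i))^-1) pit.

Variable pit : C.

Definition Dj (j : nat) : C :=
  \prod_(i < j) (theta ^+ (qq ^ j) - theta ^+ (qq ^ i)).

Definition omega : nat -> C :=
  Tlim (fun n i => \sum_(j < n)
          pit ^+ (qq ^ j) / Dj j * inv_ct (theta ^+ (qq ^ j)) i).

Definition chi_t (z : C) : nat -> C :=
  Tmul (Tinv omega)
    (Tlim (fun n i => \sum_(j < n)
          pit ^+ (qq ^ j) * z ^+ (qq ^ j) / Dj j * inv_ct (theta ^+ (qq ^ j)) i)).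

(* the two components of the vectorial Eisenstein series E_k(z),
   summed over the boxes deg a, deg b < n *)
Definition Eis1 (k : nat) (z : C) : nat -> C :=
  Tlim (fun n i => \sum_(f : {ffun 'I_n -> F}) \sum_(g : {ffun 'I_n -> F})
     if (polyN f == 0) && (polyN g == 0) then 0
     else (embA (polyN f) * z + embA (polyN g)) ^- k * tateA (polyN f) i).
Definition Eis2 (k : nat) (z : C) : nat -> C :=
  Tlim (fun n i => \sum_(f : {ffun 'I_n -> F}) \sum_(g : {ffun 'I_n -> F})
     if (polyN f == 0) && (polyN g == 0) then 0
     else (embA (polyN f) * z + embA (polyN g)) ^- k * tateA (polyN g) i).

Definition Lchi (k : nat) : nat -> C :=
  Tlim (fun n i => \sum_(d < n) \sum_(f : {ffun 'I_d -> F})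
     tateA (monicN f) i * embA (monicN f) ^- k).

Definition zetaC (m : nat) : C :=
  Clim (fun n => \sum_(d < n) \sum_(f : {ffun 'I_d -> F}) embA (monicN f) ^- m).

Definition GossE (m : nat) (z : C) : C :=
  Clim (fun n => \sum_(f : {ffun 'I_n -> F}) \sum_(g : {ffun 'I_n -> F})
     if (polyN f == 0) && (polyN g == 0) then 0
     else (embA (polyN f) * z + embA (polyN g)) ^- m).

Definition uC (z : C) : C :=
  pit^-1 * Clim (fun n => \sum_(f : {ffun 'I_n -> F}) (z - embA (polyN f))^-1).

Definition latsum (m : nat) (z : C) : C :=
  Clim (fun n => \sum_(f : {ffun 'I_n -> F}) (z - embA (polyN f)) ^- m).

Definition is_goss (G : nat -> {poly C}) : Prop :=
  forall k z, (0 < k)%N -> Omega z -> (G k).[uC z] = pit ^- k * latsum k z.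

Definition lambdak (k : nat) (z : C) : nat -> C :=
  fun i => - (Lchi k i / pit ^+ k)
    + Tmul (Tinv omega)
        (fun i' => \sum_(l < k | (qq ^ l < k)%N)
           (zetaC (k - qq ^ l) + GossE (k - qq ^ l) z)
             / (pit ^+ (k - qq ^ l) * Dj l) * inv_ct (theta ^+ (qq ^ l)) i') i.

Definition RHS1 (G : nat -> {poly C}) (k : nat) (z : C) : nat -> C :=
  Tlim (fun n i => \sum_(d < n) \sum_(f : {ffun 'I_d -> F})
     - tateA (monicN f) i * (G k).[uC (embA (monicN f) * z)]).
Definition RHS2 (G : nat -> {poly C}) (k : nat) (z : C) : nat -> C :=
  Tlim (fun n i => \sum_(d < n) \sum_(f : {ffun 'I_d -> F})
     chi_t (embA (monicN f) * z) i * (G k).[uC (embA (monicN f) * z)]).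

End Carlitz.

(* Main.v *)
(* Put S_m(w) = sum_{b in A} (w + b)^-m. Since k = 1 mod q - 1, grouping the
   pairs (a, b) by scalar multiples (there are q - 1 = -1 of them) turns the
   double sums into minus sums over a monic; the strong triangle inequality and
   |az + b| >= max(|a|, |b|/|z|), valid once |z|_Im >= 1, justify every
   rearrangement. This settles the first component, and for the second it remains to show, for w = az, that
     chi_t(w) S_k(w) + sum_b b(t) (w + b)^-k
       = omega^-1 sum_{q^l < k} pit^(q^l) / ((theta^(q^l) - t) D_l) S_{k - q^l}(w).
   As chi_t is additive with chi_t(b) = b(t), the left side is
   sum_b chi_t(w + b) (w + b)^-k. Expand chi_t as a series in (w + b)^(q^j): for
   q^j >= k the power sums of exponent q^j - k over the b of degree < n vanish
   when j < n, and the terms with j >= n tend to 0.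

   The coefficient of t^i in omega chi_t(w) is exp_C(pit w / theta^(i+1)), so
   chi_t(b) = b(t) amounts to exp_C(pit A) = 0. To get exp_C(pit) = 0 from the
   product formula, let p_n be its partial products: the coefficients of log_C
   are p_{d+1} / r^(q^(d+1)), so that exp_C o log_C = id reads
   sum_{i <= d} p_{d+1-i}^(q^i) / D_i = 0 for d >= 1; let d go to infinity. *)
Require Import Defs.
From HB Require Import structures.
From mathcomp Require Import all_boot all_order all_algebra all_field.
From mathcomp Require Import reals ring zify.
From Stdlib Require Import ClassicalEpsilon FunctionalExtensionality.
Set Implicit Arguments. Unset Strict Implicit. Unset Printing Implicit Defensive.
Import Order.TTheory GRing.Theory Num.Theory.
Local Open Scope ring_scope.

(** * Power sums over finite vector spaces *)

Section FiniteField.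
Variables (C : fieldType) (F : finFieldType) (iota : {rmorphism F -> C}).
Local Notation q := #|F|.

Lemma card_gt1 : (1 < q)%N. Proof. exact: finNzRing_gt1. Qed.

Lemma pnat_card_pow s : [pchar C].-nat (q ^ s)%N.
Proof.
have [p p_pr charFp] := finPcharP F.
have charCp := rmorph_pchar iota charFp.
rewrite pnatX (eq_pnat _ (pcharf_eq charCp)) (card_pprimeChar charFp).
by rewrite pnatX pnat_id.
Qed.

Lemma exp0_card_pow s : 0 ^+ (q ^ s) = 0 :> C.
Proof. by rewrite expr0n expn_eq0 -[q]prednK ?(ltnW card_gt1). Qed.

Lemma frobD s (x y : C) : (x + y) ^+ (q ^ s) = x ^+ (q ^ s) + y ^+ (q ^ s).
Proof. exact: exprDn_pchar (pnat_card_pow s). Qed.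

Lemma frobN s (x : C) : (- x) ^+ (q ^ s) = - x ^+ (q ^ s).
Proof. by apply/eqP; rewrite -addr_eq0 -frobD addNr exp0_card_pow. Qed.

Lemma frobB s (x y : C) : (x - y) ^+ (q ^ s) = x ^+ (q ^ s) - y ^+ (q ^ s).
Proof. by rewrite frobD frobN. Qed.

Lemma frob_sum s (I : Type) (r : seq I) (P : pred I) (f : I -> C) :
  (\sum_(i <- r | P i) f i) ^+ (q ^ s) = \sum_(i <- r | P i) f i ^+ (q ^ s).
Proof.
exact: (big_morph (fun x => x ^+ (q ^ s)) (frobD s) (exp0_card_pow s)).
Qed.

Lemma frob1B (x y : C) : (x - y) ^+ q = x ^+ q - y ^+ q.
Proof. by have := frobB 1 x y; rewrite expn1. Qed.

Lemma frob1_sum (I : Type) (r : seq I) (P : pred I) (f : I -> C) :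
  (\sum_(i <- r | P i) f i) ^+ q = \sum_(i <- r | P i) f i ^+ q.
Proof. by have := frob_sum 1 r P f; rewrite expn1. Qed.

Lemma frob_iota s (c : F) : iota c ^+ (q ^ s) = iota c.
Proof.
elim: s => [|s IH]; first by rewrite expn0 expr1.
by rewrite expnS mulnC exprM IH -rmorphXn expf_card.
Qed.

Lemma iota_exp_pred (c : F) : c != 0 -> iota c ^+ q.-1 = 1.
Proof.
move=> c0; have ic0 : iota c != 0 by rewrite fmorph_eq0.
apply: (mulfI ic0); rewrite mulr1 -exprS prednK ?(ltnW card_gt1) //.
by rewrite -[in RHS](frob_iota 1 c) expn1.
Qed.

Lemma natr_card : q%:R = 0 :> C.
Proof.
have [p p_pr charFp] := finPcharP F.
have charCp := rmorph_pchar iota charFp.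
have := card_gt1; rewrite (card_pprimeChar charFp); case: (logn _ _) => // n _.
by apply/eqP; rewrite -(dvdn_pcharf charCp) dvdn_exp.
Qed.

(** For n = 0 the sum is q = 0. For n > 0 the polynomial X^n - 1 has fewer than q - 1 roots, so some
    g != 0 has g^n != 1, and the substitution c -> gc multiplies the sum by g^n. *)
Lemma sum_iota_exp n : (n < q.-1)%N -> \sum_(c : F) iota c ^+ n = 0.
Proof.
case: n => [_|n nq].
  by under eq_bigr do rewrite expr0; rewrite sumr_const natr_card.
have [g g0 gn] : exists2 g : F, g != 0 & g ^+ n.+1 != 1.
  apply/exists_inP; apply: contraT; rewrite negb_exists_in => /forall_inP H.
  have X1 : 'X^(n.+1) - 1%:P != 0 :> {poly F} by rewrite -size_poly_eq0 size_XnsubC.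
  have := max_poly_roots X1 (rs := enum [pred c : F | c != 0]).
  rewrite enum_uniq size_XnsubC // -cardE cardC1.
  move=> /(_ _ isT) => H2; suff : (q.-1 < n.+2)%N by lia.
  apply: H2; apply/allP => c; rewrite mem_enum inE => c0.
  by rewrite rootE !hornerE subr_eq0; apply/negPn/H.
set S := \sum_(c : F) _.
have : iota g ^+ n.+1 * S = S.
  rewrite /S mulr_sumr [RHS](reindex_inj (mulfI g0)).
  by apply: eq_bigr => c _; rewrite rmorphM exprMn.
move/eqP; rewrite -subr_eq0 -{2}[S]mul1r -mulrBl mulf_eq0 => /orP[|/eqP//].
by rewrite -rmorphXn -(rmorph1 iota) -rmorphB fmorph_eq0 subr_eq0 (negPf gn).
Qed.

(* Chevalley--Warning: in every monomial some variable has degree < q - 1. *)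
Lemma sum_prod_affine n N (u : 'I_N -> C) (v : 'I_N -> 'I_n -> C) :
  (N < n * q.-1)%N ->
  \sum_(f : {ffun 'I_n -> F}) \prod_s (u s + \sum_i iota (f i) * v s i) = 0.
Proof.
move=> Nn.
(* Homogenise: index 0 carries the variable 1 with coefficient [u s], so each affine form becomes a
   linear form in n + 1 variables and the product expands into monomials. *)
pose X (f : {ffun 'I_n -> F}) (o : 'I_n.+1) :=
  oapp (fun i => iota (f i)) 1 (unlift ord0 o).
pose V s (o : 'I_n.+1) := oapp (v s) (u s) (unlift ord0 o).
have XV (f : {ffun 'I_n -> F}) s : u s + \sum_i iota (f i) * v s i = \sum_o X f o * V s o.
  rewrite big_ord_recl /X /V unlift_none /= mul1r.
  by congr (_ + _); apply: eq_bigr => i _; rewrite liftK.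
under eq_bigr do under eq_bigr do rewrite XV.
under eq_bigr do rewrite bigA_distr_bigA.
rewrite exchange_big /=; apply: big1 => h _.
(* [h] picks one variable from each factor; [e i] is the exponent of the i-th variable in the
   resulting monomial. *)
pose e i := #|[pred s | unlift ord0 (h s) == Some i]|.
have Xh (f : {ffun 'I_n -> F}) : \prod_s X f (h s) = \prod_i iota (f i) ^+ e i.
  transitivity (\prod_s \prod_i (if unlift ord0 (h s) == Some i then iota (f i) else 1)).
    apply: eq_bigr => s _; rewrite /X; case: (unlift _ _) => [j|] /=; last first.
      by rewrite big1.
    rewrite (bigD1 j) //= eqxx big1 ?mulr1 // => i /negPf ij.
    by rewrite (inj_eq Some_inj) eq_sym ij.
  rewrite exchange_big; apply: eq_bigr => i _.
  by rewrite -big_mkcond prodr_const.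
under eq_bigr do rewrite big_split /= Xh.
rewrite -mulr_suml -(bigA_distr_bigA (fun i c => iota c ^+ e i)).
(* The exponents add up to at most N < n(q - 1), so they cannot all reach q - 1. *)
have [i ei] : exists i, (e i < q.-1)%N.
  apply/existsP; apply: contraT; rewrite negb_exists => /forallP H.
  have : (n * q.-1 <= \sum_(i < n) e i)%N.
    rewrite -{1}(card_ord n) -sum_nat_const; apply: leq_sum => i _.
    by rewrite leqNgt H.
  rewrite leqNgt (leq_ltn_trans _ Nn) //.
  under eq_bigr do rewrite /e -sum1_card big_mkcond.
  rewrite exchange_big /= -[leqRHS]card_ord -sum1_card.
  apply: leq_sum => s _.
  under eq_bigr do rewrite inE.
  case: (unlift _ _) => [j|]; last by rewrite big1.
  rewrite (bigD1 j) //= eqxx big1 // => i /negPf ij.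
  by rewrite (inj_eq Some_inj) eq_sym ij.
by rewrite (bigD1 i) //= sum_iota_exp // !mul0r.
Qed.

(** Base-q expansion: there are j digits, each at most q - 1, and [e] lists the exponents with
    multiplicity. *)
Lemma qdigits j m : (m < q ^ j)%N ->
  exists2 e : seq nat, (size e <= j * q.-1)%N & m = (\sum_(s <- e) q ^ s)%N.
Proof.
have q1 := card_gt1.
elim: j m => [|j IH] m.
  by rewrite expn0 ltnS leqn0 => /eqP ->; exists [::]; rewrite ?big_nil.
rewrite expnSr -ltn_divLR ?(ltnW q1) // => /IH[e se def_m].
exists (nseq (m %% q) 0%N ++ map succn e).
  rewrite size_cat size_nseq size_map mulSn leq_add // -ltnS prednK ?(ltnW q1) //.
  by rewrite ltn_mod (ltnW q1).
rewrite big_cat big_map {1}(divn_eq m q) addnC def_m big_distrl /=.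
congr (_ + _)%N; last by apply: eq_bigr => s _; rewrite expnSr.
by rewrite big_nseq expn0 iter_addn_0 mul1n.
Qed.

(** By the base-q expansion of m and Frobenius, x^m is a product of at most j(q - 1) < n(q - 1)
    factors x^(q^s), each affine in the coordinates of f. *)
Lemma sum_affine_pow n j m (w : C) (v : 'I_n -> C) : (j < n)%N -> (m < q ^ j)%N ->
  \sum_(f : {ffun 'I_n -> F}) (w + \sum_i iota (f i) * v i) ^+ m = 0.
Proof.
move=> jn /qdigits[e se ->].
have H (x : C) : x ^+ (\sum_(s <- e) q ^ s) = \prod_(s <- e) x ^+ (q ^ s).
  by elim: e {se} => [|a e IH]; rewrite ?big_nil ?big_cons // exprD IH.
transitivity (\sum_(f : {ffun 'I_n -> F}) \prod_(s < size e)
   (w ^+ (q ^ tnth (in_tuple e) s) +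
     \sum_i iota (f i) * v i ^+ (q ^ tnth (in_tuple e) s))).
  apply: eq_bigr => f _; rewrite H big_tnth; apply: eq_bigr => s _.
  rewrite frobD frob_sum; congr (_ + _); apply: eq_bigr => i _.
  by rewrite exprMn frob_iota.
apply: sum_prod_affine; apply: leq_ltn_trans se _.
by rewrite ltn_mul2r jn andbT -ltnS prednK ?card_gt1 // (ltnW card_gt1).
Qed.

End FiniteField.

(** * Sums over polynomials of bounded degree *)

Section TruncatedPolynomials.
Variables (C : closedFieldType) (F : finFieldType) (iota : {rmorphism F -> C}).
Variable theta : C.
Local Notation q := #|F|.
Local Notation embA := (embA iota theta).
Local Notation tateA := (tateA iota).

Lemma embA0 : embA 0 = 0. Proof. by rewrite /Defs.embA rmorph0 horner0. Qed.
Lemma embAD a b : embA (a + b) = embA a + embA b.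
Proof. by rewrite /Defs.embA rmorphD hornerD. Qed.
Lemma embAN a : embA (- a) = - embA a.
Proof. by rewrite /Defs.embA rmorphN hornerN. Qed.
Lemma embAM a b : embA (a * b) = embA a * embA b.
Proof. by rewrite /Defs.embA rmorphM hornerM. Qed.
Lemma embAC c : embA c%:P = iota c.
Proof. by rewrite /Defs.embA map_polyC hornerC. Qed.
Lemma embAZ c a : embA (c *: a) = iota c * embA a.
Proof. by rewrite -mul_polyC embAM embAC. Qed.
Lemma embAX : embA 'X = theta.
Proof. by rewrite /Defs.embA map_polyX hornerX. Qed.

Lemma embA_coef n (a : {poly F}) : (size a <= n)%N ->
  embA a = \sum_(i < n) iota a`_i * theta ^+ i.
Proof.
move=> an; rewrite /Defs.embA (@horner_coef_wide _ n) ?size_map_poly //.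
by apply: eq_bigr => i _; rewrite coef_map.
Qed.

Lemma tateAZ c a i : tateA (c *: a) i = iota c * tateA a i.
Proof. by rewrite /Defs.tateA coefZ rmorphM. Qed.
Lemma tateA0 i : tateA 0 i = 0.
Proof. by rewrite /Defs.tateA coef0 rmorph0. Qed.

Lemma coef_polyN n (f : {ffun 'I_n -> F}) (i : 'I_n) : (polyN f)`_i = f i.
Proof. by rewrite coef_Poly nth_fgraph_ord. Qed.

Lemma size_polyN n (f : {ffun 'I_n -> F}) : (size (polyN f) <= n)%N.
Proof. by apply: leq_trans (size_Poly _) _; rewrite size_tuple card_ord. Qed.

Lemma polyN_eqP n (f : {ffun 'I_n -> F}) (p : {poly F}) :
  (size p <= n)%N -> (forall i : 'I_n, p`_i = f i) -> polyN f = p.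
Proof.
move=> pn fp; apply/polyP => i; case: (ltnP i n) => [lin|nin].
  by rewrite (coef_polyN f (Ordinal lin)) -fp.
by rewrite !nth_default // (leq_trans _ nin) // size_polyN.
Qed.

Lemma embA_polyN n (f : {ffun 'I_n -> F}) :
  embA (polyN f) = \sum_(i < n) iota (f i) * theta ^+ i.
Proof.
rewrite (embA_coef (size_polyN f)).
by apply: eq_bigr => i _; rewrite coef_polyN.
Qed.

Lemma monicNE d (f : {ffun 'I_d -> F}) : monicN f = 'X^d + polyN f.
Proof. by []. Qed.

Lemma size_monicN d (f : {ffun 'I_d -> F}) : size (monicN f) = d.+1.
Proof. by rewrite monicNE size_polyDl size_polyXn // ltnS size_polyN. Qed.

Lemma monicN_neq0 d (f : {ffun 'I_d -> F}) : monicN f != 0.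
Proof. by rewrite -size_poly_eq0 size_monicN. Qed.

Lemma polyN_scale n c (f : {ffun 'I_n -> F}) : polyN [ffun i => c * f i] = c *: polyN f.
Proof.
apply: polyN_eqP => [|i].
  by apply: leq_trans (size_scale_leq _ _) (size_polyN f).
by rewrite coefZ coef_polyN ffunE.
Qed.

Lemma sum_polyN_scale n c (H : {poly F} -> C) : c != 0 ->
  \sum_(f : {ffun 'I_n -> F}) H (polyN f) =
  \sum_(f : {ffun 'I_n -> F}) H (c *: polyN f).
Proof.
move=> c0.
have inj : injective (fun f : {ffun 'I_n -> F} => [ffun i => c * f i]).
  move=> f g /ffunP fg; apply/ffunP => i.
  by have := fg i; rewrite !ffunE => /(mulfI c0).
rewrite (reindex_inj inj); apply: eq_bigr => f _.
by rewrite polyN_scale.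
Qed.

Lemma sum_polyN_recr n (H : {poly F} -> C) :
  \sum_(f : {ffun 'I_n.+1 -> F}) H (polyN f) =
  \sum_(c : F) \sum_(g : {ffun 'I_n -> F}) H (c *: 'X^n + polyN g).
Proof.
(* [h] attaches c as the top coefficient, at [ord_max]. *)
pose h (cg : F * {ffun 'I_n -> F}) : {ffun 'I_n.+1 -> F} :=
  [ffun i => oapp cg.2 cg.1 (unlift ord_max i)].
pose h' (f : {ffun 'I_n.+1 -> F}) : F * {ffun 'I_n -> F} :=
  (f ord_max, [ffun j => f (lift ord_max j)]).
have hK : cancel h h'.
  move=> [c g]; rewrite /h /h' ffunE unlift_none /=; congr (_, _).
  by apply/ffunP => j; rewrite !ffunE liftK.
have h'K : cancel h' h.
  move=> f; apply/ffunP => i; rewrite ffunE /=.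
  by case: unliftP => [j|] -> /=; rewrite ?ffunE.
rewrite pair_big /= (reindex h) /=; last by exists h' => ? _; rewrite ?hK ?h'K.
apply: eq_bigr => -[c g] _; congr H; apply: polyN_eqP => [|i] /=.
  rewrite (leq_trans (size_polyD _ _)) // geq_max.
  rewrite (leq_trans (size_scale_leq _ _)) ?size_polyXn //.
  by rewrite (leq_trans (size_polyN _)).
rewrite coefD coefZ coefXn ffunE; case: unliftP => [j|] -> /=.
  rewrite /bump leqNgt ltn_ord add0n coef_polyN.
  by rewrite (ltn_eqF (ltn_ord j)) mulr0 add0r.
by rewrite eqxx mulr1 nth_default ?addr0 // size_polyN.
Qed.

Lemma sum_polyN_monic n (H : {poly F} -> C) :
  \sum_(f : {ffun 'I_n -> F}) H (polyN f) =
  H 0 + \sum_(d < n) \sum_(f : {ffun 'I_d -> F}) \sum_(c | c != 0) H (c *: monicN f).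
Proof.
elim: n => [|n IH].
  rewrite big_ord0 addr0 (bigD1 [ffun=> 0]) //= big1 ?addr0.
    by congr H; apply: polyN_eqP => [|[]//]; rewrite size_poly0.
  by move=> f; have -> : f = [ffun=> 0] by [apply/ffunP => -[]]; rewrite eqxx.
rewrite sum_polyN_recr (bigD1 0) //= big_ord_recr /= addrA -IH; congr (_ + _).
  by apply: eq_bigr => g _; rewrite scale0r add0r.
rewrite exchange_big /=; rewrite [RHS]exchange_big /= exchange_big /=.
apply: eq_bigr => c c0.
(* Rescaling the lower coefficients by c turns c X^n + g into c times a monic polynomial. *)
rewrite (@sum_polyN_scale n c (fun p => H (c *: 'X^n + p))) //.
by apply: eq_bigr => g _; rewrite monicNE scalerDr.
Qed.

Lemma natr_card_pred : \sum_(c : F | c != 0) (1 : C) = -1.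
Proof.
apply: (addrI 1); rewrite subrr -[RHS](natr_card iota).
rewrite -[in RHS]sum1_card natr_sum [RHS](bigD1 0) //=.
Qed.

Lemma sum_polyN_homogeneous n (H : {poly F} -> C) :
  (forall c a, c != 0 -> H (c *: a) = H a) ->
  \sum_(f : {ffun 'I_n -> F}) H (polyN f) =
  H 0 - \sum_(d < n) \sum_(f : {ffun 'I_d -> F}) H (monicN f).
Proof.
move=> Hc; rewrite sum_polyN_monic -sumrN; congr (_ + _).
apply: eq_bigr => d _; rewrite -sumrN; apply: eq_bigr => f _.
rewrite (eq_bigr (fun=> H (monicN f) * 1)) => [|c /Hc ->]; last by rewrite mulr1.
by rewrite -mulr_sumr natr_card_pred mulrN1.
Qed.

Lemma sum_polyN_addpow n j m (w : C) : (j < n)%N -> (m < q ^ j)%N ->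
  \sum_(f : {ffun 'I_n -> F}) (w + embA (polyN f)) ^+ m = 0.
Proof.
move=> jn mj; under eq_bigr do rewrite embA_polyN.
exact: sum_affine_pow jn mj.
Qed.

End TruncatedPolynomials.

(** * Formal power series *)

Section PowerSeries.
Variable C : closedFieldType.
Implicit Types f g h : nat -> C.

(** Low coefficients only see truncations, so the ring laws of polynomials transfer to power
    series. *)
Lemma Tmul_coef f g i n : (i < n)%N ->
  Tmul f g i = ((\poly_(j < n) f j) * (\poly_(j < n) g j))`_i.
Proof.
move=> lin; rewrite coefM; apply: eq_bigr => j _.
by rewrite !coef_poly !(leq_ltn_trans _ lin) ?leq_subr // -ltnS.
Qed.

Lemma TmulC f g i : Tmul f g i = Tmul g f i.
Proof. by rewrite !(@Tmul_coef _ _ i i.+1) // mulrC. Qed.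

Lemma TmulA f g h i : Tmul f (Tmul g h) i = Tmul (Tmul f g) h i.
Proof.
rewrite (TmulC (Tmul f g)).
have E (u v w : nat -> C) : Tmul u (Tmul v w) i =
    ((\poly_(j < i.+1) u j) * ((\poly_(j < i.+1) v j) * (\poly_(j < i.+1) w j)))`_i.
  rewrite coefM; apply: eq_bigr => j _; rewrite coef_poly ltn_ord.
  by rewrite (@Tmul_coef v w _ i.+1) // ltnS leq_subr.
by rewrite !E [in RHS]mulrC mulrA.
Qed.

Lemma eq_Tmul f f' g g' i : f =1 f' -> g =1 g' -> Tmul f g i = Tmul f' g' i.
Proof. by move=> ff gg; apply: eq_bigr => j _; rewrite ff gg. Qed.

Lemma Tmul1 f i : Tmul (Tone C) f i = f i.
Proof.
rewrite /Tmul big_ord_recl /= subn0 mul1r big1 ?addr0 // => j _.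
by rewrite /Tone mul0r.
Qed.

Lemma TmulZ c f g i : Tmul f (fun j => c * g j) i = c * Tmul f g i.
Proof. by rewrite /Tmul mulr_sumr; apply: eq_bigr => j _; rewrite mulrCA. Qed.

Lemma Tmul_sum (I : Type) (r : seq I) (P : pred I) f (g : I -> nat -> C) i :
  Tmul f (fun j => \sum_(x <- r | P x) g x j) i = \sum_(x <- r | P x) Tmul f (g x) i.
Proof.
by rewrite /Tmul exchange_big; apply: eq_bigr => j _; rewrite mulr_sumr.
Qed.

Lemma TmulB f g h i : Tmul f (fun j => g j - h j) i = Tmul f g i - Tmul f h i.
Proof. by rewrite /Tmul -sumrB; apply: eq_bigr => j _; rewrite mulrBr. Qed.

(** The first n coefficients of 1/f, obtained by solving f g = 1 degree by degree. *)
Fixpoint Tinv_rec f (n : nat) : seq C :=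
  if n is m.+1 then
    let s := Tinv_rec f m in
    rcons s ((f 0%N)^-1 * ((m == 0%N)%:R - \sum_(j < m) f (m - j)%N * s`_j))
  else [::].

(** [Tinv] is a choice, so it is enough to exhibit one formal inverse. *)
Lemma Tmul_TinvE f : f 0%N != 0 -> Tmul f (Tinv f) = Tone C.
Proof.
move=> f0; apply: (epsilon_spec (inhabits (fun=> 0)) (fun g => Tmul f g = Tone C)).
have size_rec n : size (Tinv_rec f n) = n by elim: n => //= n IH; rewrite size_rcons IH.
exists (fun i => (Tinv_rec f i.+1)`_i); apply: functional_extensionality => i.
(* Longer lists extend shorter ones, so each coefficient is fixed once computed. *)
have stable m n : (m < n)%N -> (Tinv_rec f n)`_m = (Tinv_rec f m.+1)`_m.
  elim: n => // n IH; rewrite ltnS leq_eqVlt => /orP[/eqP -> //|mn].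
  by rewrite [LHS]nth_rcons size_rec mn IH.
rewrite TmulC /Tmul big_ord_recr /= subnn nth_rcons size_rec ltnn eqxx.
rewrite mulrAC mulVf // mul1r (eq_bigr (fun j : 'I_i => f (i - j)%N * (Tinv_rec f i)`_j)).
  by rewrite addrC subrK /Tone; case: eqP.
by move=> j _; rewrite mulrC (stable _ i).
Qed.

End PowerSeries.

(** * Non-archimedean convergence *)

Section Cinfty.
Variables (R : realType) (C : closedFieldType) (F : finFieldType).
Variables (iota : {rmorphism F -> C}) (nrm : C -> R) (theta : C).
Hypothesis HC : is_Cinfty iota nrm theta.
Local Notation q := #|F|.
Local Notation embA := (embA iota theta).
Local Notation tateA := (tateA iota).
Local Notation cvgC := (cvgC nrm).
Local Notation cvgT := (cvgT nrm).

Lemma nrm_ge0 x : 0 <= nrm x. Proof. by have [] := HC. Qed.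

Lemma nrm_eq0 x : (nrm x == 0) = (x == 0).
Proof. by have [_ [H _]] := HC; apply/eqP/eqP => /H. Qed.

Lemma nrmM x y : nrm (x * y) = nrm x * nrm y.
Proof. by have [_ [_ []]] := HC. Qed.

Lemma nrmD_max x y : nrm (x + y) <= Num.max (nrm x) (nrm y).
Proof. by have [_ [_ [_ []]]] := HC. Qed.

Lemma nrm_theta : nrm theta = q%:R.
Proof. by have [_ [_ [_ [_ []]]]] := HC. Qed.

Lemma cauchy_cvg u : cauchyC nrm u -> exists l, cvgC u l.
Proof. by have [_ [_ [_ [_ [_ [H _]]]]]] := HC; apply: H. Qed.

Lemma nrm0 : nrm 0 = 0. Proof. by apply/eqP; rewrite nrm_eq0. Qed.

Lemma nrm_gt0 x : (0 < nrm x) = (x != 0).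
Proof. by rewrite lt_def nrm_ge0 nrm_eq0 andbT. Qed.

Lemma nrm1 : nrm 1 = 1.
Proof.
have n1 : nrm 1 != 0 by rewrite nrm_eq0 oner_eq0.
by apply: (mulfI n1); rewrite -nrmM !mulr1.
Qed.

Lemma nrmX x n : nrm (x ^+ n) = nrm x ^+ n.
Proof. by elim: n => [|n IH]; rewrite ?expr0 ?nrm1 // !exprS nrmM IH. Qed.

Lemma nrmV x : nrm x^-1 = (nrm x)^-1.
Proof.
have [->|x0] := eqVneq x 0; first by rewrite invr0 nrm0 invr0.
have nx0 : nrm x != 0 by rewrite nrm_eq0.
by apply: (mulfI nx0); rewrite -nrmM !divff ?nrm1.
Qed.

Lemma nrmN x : nrm (- x) = nrm x.
Proof.
rewrite -mulN1r nrmM; suff /eqP-> : nrm (-1) == 1 by rewrite mul1r.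
by rewrite -(@pexpr_eq1 _ _ 2) ?nrm_ge0 // -nrmX sqrrN expr1n nrm1.
Qed.

Lemma nrm_distC x y : nrm (x - y) = nrm (y - x).
Proof. by rewrite -nrmN opprB. Qed.

Lemma nrmD_le x y B : nrm x <= B -> nrm y <= B -> nrm (x + y) <= B.
Proof.
by move=> xB yB; apply: le_trans (nrmD_max x y) _; rewrite ge_max xB.
Qed.

Lemma nrmB_le x y B : nrm x <= B -> nrm y <= B -> nrm (x - y) <= B.
Proof. by move=> xB yB; apply: nrmD_le; rewrite ?nrmN. Qed.

Lemma nrmD_lt x y B : nrm x < B -> nrm y < B -> nrm (x + y) < B.
Proof.
by move=> xB yB; apply: le_lt_trans (nrmD_max x y) _; rewrite gt_max xB.
Qed.

Lemma nrm_dist_le y x z B : nrm (x - y) <= B -> nrm (y - z) <= B -> nrm (x - z) <= B.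
Proof. by move=> xy yz; rewrite -[x](subrK y) -addrA; apply: nrmD_le. Qed.

Lemma nrm_dist_lt y x z B : nrm (x - y) < B -> nrm (y - z) < B -> nrm (x - z) < B.
Proof. by move=> xy yz; rewrite -[x](subrK y) -addrA; apply: nrmD_lt. Qed.

Lemma nrm_sum_le (I : Type) (r : seq I) (P : pred I) (f : I -> C) B : 0 <= B ->
  (forall i, P i -> nrm (f i) <= B) -> nrm (\sum_(i <- r | P i) f i) <= B.
Proof.
move=> B0 fB; apply: (big_ind (fun x => nrm x <= B)) => //; first by rewrite nrm0.
by move=> x y; apply: nrmD_le.
Qed.

Lemma nrm_prod (I : Type) (s : seq I) (P : pred I) (f : I -> C) :
  nrm (\prod_(i <- s | P i) f i) = \prod_(i <- s | P i) nrm (f i).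
Proof. exact: (big_morph nrm nrmM nrm1). Qed.

(** If x + y were smaller than y, then y = (x + y) - x would be smaller than itself. *)
Lemma nrm_dominant x y : nrm x < nrm y -> nrm (x + y) = nrm y.
Proof.
move=> xy; apply/eqP; rewrite eq_le nrmD_le ?(ltW xy) //=.
rewrite leNgt; apply/negP => H; have := nrmD_lt (x := x + y) (y := - x) H.
by rewrite nrmN addrAC subrr add0r ltxx => /(_ xy).
Qed.

Lemma q_gt1 : 1 < q%:R :> R. Proof. by rewrite ltr1n card_gt1. Qed.
Lemma q_gt0 : 0 < q%:R :> R. Proof. exact: lt_trans q_gt1. Qed.
Lemma q_ge1 : 1 <= q%:R :> R. Proof. exact: ltW q_gt1. Qed.
Lemma qX_gt0 n : 0 < q%:R ^+ n :> R. Proof. exact: exprn_gt0 q_gt0. Qed.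

Lemma theta_neq0 : theta != 0.
Proof. by rewrite -nrm_eq0 nrm_theta gt_eqF ?q_gt0. Qed.

Lemma nrm_iota c : c != 0 -> nrm (iota c) = 1.
Proof.
move=> c0; apply/eqP; rewrite -(@pexpr_eq1 _ _ q.-1) ?nrm_ge0 //.
  by rewrite -nrmX iota_exp_pred // nrm1.
by rewrite -ltnS prednK ?card_gt1 // (ltnW (card_gt1 F)).
Qed.

Lemma nrm_iota_le1 c : nrm (iota c) <= 1.
Proof.
have [->|/nrm_iota -> //] := eqVneq c 0; by rewrite rmorph0 nrm0 ler01.
Qed.

(** Horner's scheme: the constant added at each step has norm at most 1 and is dominated, as |theta|
    = q > 1. *)
Lemma nrm_embA a : a != 0 -> nrm (embA a) = q%:R ^+ (size a).-1.
Proof.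
elim/poly_ind: a => [|p c IH]; first by rewrite eqxx.
rewrite embAD embAM embAX embAC size_MXaddC.
have [->|p0] := eqVneq p 0.
  rewrite mul0r add0r embA0 mul0r add0r polyC_eq0 => c0.
  by rewrite (negPf c0) size_poly0 expr0 nrm_iota.
move=> _ /=; have E : nrm (embA p * theta) = q%:R ^+ size p.
  by rewrite nrmM nrm_theta IH // -exprSr prednK ?size_poly_gt0.
rewrite addrC nrm_dominant ?E //; apply: le_lt_trans (nrm_iota_le1 c) _.
by rewrite exprn_egt1 ?q_gt1 // size_poly_eq0.
Qed.

Lemma embA_eq0 a : (embA a == 0) = (a == 0).
Proof.
have [->|a0] := eqVneq a 0; first by rewrite embA0 eqxx.
by rewrite -nrm_eq0 nrm_embA // gt_eqF ?qX_gt0.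
Qed.

Lemma geo_small (B e : R) : 0 < e ->
  exists N, forall n, (N <= n)%N -> B / q%:R ^+ n < e.
Proof.
move=> e0; have [N BN] : exists N : nat, B / e < N%:R.
  exists (Num.bound `|B / e|); apply: le_lt_trans (ler_norm _) _.
  by apply: archi_boundP; apply: normr_ge0.
exists N => n Nn; rewrite ltr_pdivrMr ?qX_gt0 // mulrC -ltr_pdivrMr //.
apply: lt_le_trans BN _; rewrite -natrX ler_nat.
by apply: leq_trans Nn (ltnW (ltn_expl _ (card_gt1 F))).
Qed.

Lemma geo_anti (B : R) m n : 0 <= B -> (m <= n)%N -> B / q%:R ^+ n <= B / q%:R ^+ m.
Proof.
move=> B0 mn; apply: ler_wpM2l => //.
by rewrite lef_pV2 ?posrE ?qX_gt0 // ler_weXn2l ?q_ge1.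
Qed.

Lemma geo_ge0 (B : R) n : 0 <= B -> 0 <= B / q%:R ^+ n.
Proof. by move=> B0; rewrite divr_ge0 // ltW ?qX_gt0. Qed.

(** * Limits in [C] and in the Tate algebra *)

Lemma cvgC_unique u l l' : cvgC u l -> cvgC u l' -> l = l'.
Proof.
move=> ul ul'; apply/eqP; rewrite -subr_eq0 -nrm_eq0; apply: contraT => ll.
have e0 : 0 < nrm (l - l') by rewrite lt_def ll nrm_ge0.
have [N H] := ul _ e0; have [N' H'] := ul' _ e0.
have := nrm_dist_lt (y := u (maxn N N')) (x := l) (z := l') (B := nrm (l - l')).
by rewrite ltxx nrm_distC H ?leq_maxl // H' ?leq_maxr // => /(_ isT isT).
Qed.

Lemma cvgT_cvgC u l i : cvgT u l -> cvgC (u^~ i) (l i).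
Proof. by move=> ul e /ul[N H]; exists N => n /H. Qed.

Lemma cvgT_const u l : cvgC u l -> cvgT (fun n _ => u n) (fun=> l).
Proof. by move=> ul e /ul[N H]; exists N => n /H. Qed.

(** [Tlim] is a choice; uniqueness of limits in each coefficient identifies it with any exhibited
    limit. *)
Lemma TlimE u l : cvgT u l -> Tlim nrm u =1 l.
Proof.
move=> ul i; have := epsilon_spec (inhabits (fun=> 0)) (fun l => cvgT u l)
  (ex_intro _ l ul).
by move=> ul'; apply: cvgC_unique (cvgT_cvgC i ul') (cvgT_cvgC i ul).
Qed.

Lemma ClimE u l : cvgC u l -> Clim nrm u = l.
Proof.
move=> ul; have ul' := epsilon_spec (inhabits 0) (fun l => cvgC u l) (ex_intro _ l ul).
exact: cvgC_unique ul' ul.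
Qed.

Lemma cvgC_ext u v l : u =1 v -> cvgC u l -> cvgC v l.
Proof. by move=> uv ul e /ul[N H]; exists N => n; rewrite -uv => /H. Qed.

Lemma cvgT_ext u v l l' : (forall n, u n =1 v n) -> l =1 l' -> cvgT u l -> cvgT v l'.
Proof. by move=> uv ll ul e /ul[N H]; exists N => n /H Hn i; rewrite -uv -ll. Qed.

Lemma cvgC_le u l x B : cvgC u l ->
  (exists N, forall n, (N <= n)%N -> nrm (u n - x) <= B) -> nrm (l - x) <= B.
Proof.
move=> ul [N uB]; rewrite leNgt; apply/negP => Bl.
have e0 : 0 < nrm (l - x).
  by apply: le_lt_trans Bl; apply: le_trans (uB N (leqnn N)); apply: nrm_ge0.
have [N' H] := ul _ e0; have := H (maxn N N') (leq_maxr _ _).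
rewrite nrm_distC => ln.
have := nrm_dist_lt ln (le_lt_trans (uB _ (leq_maxl N N')) Bl).
by rewrite ltxx.
Qed.

Lemma cvgT_geo u l N B :
  (forall n i, (N <= n)%N -> nrm (u n i - l i) <= B / q%:R ^+ n) -> cvgT u l.
Proof.
move=> ul e /(geo_small B)[N' H]; exists (maxn N N') => n; rewrite geq_max.
by move=> /andP[Nn N'n] i; apply: le_lt_trans (ul _ _ Nn) (H _ N'n).
Qed.

Lemma cvgT_near u v l : cvgT u l ->
  (forall e, 0 < e -> exists N, forall n, (N <= n)%N -> forall i, nrm (v n i - u n i) < e) ->
  cvgT v l.
Proof.
move=> ul vu e e0; have [N H] := ul e e0; have [N' H'] := vu e e0.
exists (maxn N N') => n; rewrite geq_max => /andP[Nn N'n] i.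
exact: nrm_dist_lt (H' _ N'n i) (H _ Nn i).
Qed.

Lemma cvgT_near_geo u v l B : cvgT u l ->
  (forall n i, nrm (v n i - u n i) <= B / q%:R ^+ n) -> cvgT v l.
Proof.
move=> ul vu; apply: cvgT_near ul _ => e /(geo_small B)[N H]; exists N => n Nn i.
exact: le_lt_trans (vu _ _) (H _ Nn).
Qed.

Lemma cvgC_near_geo u v l N B : cvgC u l ->
  (forall n, (N <= n)%N -> nrm (v n - u n) <= B / q%:R ^+ n) -> cvgC v l.
Proof.
move=> ul vu e e0; have [N1 H1] := ul e e0; have [N2 H2] := geo_small B e0.
exists (maxn N (maxn N1 N2)) => n; rewrite !geq_max => /and3P[Nn N1n N2n].
exact: nrm_dist_lt (le_lt_trans (vu _ Nn) (H2 _ N2n)) (H1 _ N1n).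
Qed.

Lemma cvgC_shift u l : cvgC (fun n => u n.+1) l -> cvgC u l.
Proof.
by move=> ul e /ul[N H]; exists N.+1 => -[//|n]; rewrite ltnS => /H.
Qed.

(** Limits exist in each coefficient because [C] is complete; the bound is uniform in i, so it
    passes to them and yields convergence in the Gauss norm. *)
Lemma cvgT_complete u N B : 0 <= B ->
  (forall n m i, (N <= n <= m)%N -> nrm (u m i - u n i) <= B / q%:R ^+ n) ->
  exists2 l, cvgT u l & forall n i, (N <= n)%N -> nrm (l i - u n i) <= B / q%:R ^+ n.
Proof.
move=> B0 uB.
have uc i : cauchyC nrm (u^~ i).
  move=> e /(geo_small B)[N' H]; exists (maxn N N') => n m; rewrite !geq_max.
  move=> /andP[Nn N'n] /andP[Nm N'm]; case: (leqP n m) => [nm|/ltnW mn].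
    by rewrite nrm_distC; apply: le_lt_trans (uB _ _ _ _) (H _ N'n); rewrite Nn.
  by apply: le_lt_trans (uB _ _ _ _) (H _ N'm); rewrite Nm.
pose l i := epsilon (inhabits 0) (fun l => cvgC (u^~ i) l).
have ul i : cvgC (u^~ i) (l i).
  exact: epsilon_spec (inhabits 0) (fun l => cvgC (u^~ i) l) (cauchy_cvg (uc i)).
have lB n i : (N <= n)%N -> nrm (l i - u n i) <= B / q%:R ^+ n.
  move=> Nn; apply: cvgC_le (ul i) _; exists n => m nm.
  by apply: uB; rewrite Nn.
exists l => //; apply: (cvgT_geo (N := N) (B := B)) => n i Nn.
by rewrite nrm_distC lB.
Qed.

(** By the ultrametric inequality, bounds on consecutive differences control all later ones. *)
Lemma cvgT_step u N B : 0 <= B ->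
  (forall n i, (N <= n)%N -> nrm (u n.+1 i - u n i) <= B / q%:R ^+ n) ->
  exists2 l, cvgT u l & forall n i, (N <= n)%N -> nrm (l i - u n i) <= B / q%:R ^+ n.
Proof.
move=> B0 uB; apply: cvgT_complete => // n m i /andP[Nn].
elim: m => [|m IH]; first by rewrite leqn0 => /eqP ->; rewrite subrr nrm0 geo_ge0.
rewrite leq_eqVlt => /orP[/eqP->|]; first by rewrite subrr nrm0 geo_ge0.
rewrite ltnS => nm; apply: nrm_dist_le (IH nm).
by apply: le_trans (uB _ _ (leq_trans Nn nm)) _; apply: geo_anti.
Qed.

Lemma cvgC_D u v l l' : cvgC u l -> cvgC v l' -> cvgC (fun n => u n + v n) (l + l').
Proof.
move=> ul vl e e0; have [N H] := ul e e0; have [N' H'] := vl e e0.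
exists (maxn N N') => n; rewrite geq_max => /andP[Nn N'n].
by rewrite opprD addrACA; apply: nrmD_lt (H _ Nn) (H' _ N'n).
Qed.

Lemma cvgC_M c u l : cvgC u l -> cvgC (fun n => c * u n) (c * l).
Proof.
move=> ul e e0; have [->|c0] := eqVneq c 0.
  by exists 0%N => n _; rewrite !mul0r subrr nrm0.
have [|N H] := ul (e / nrm c); first by rewrite divr_gt0 ?nrm_gt0.
by exists N => n /H; rewrite -mulrBr nrmM ltr_pdivlMr ?nrm_gt0 // mulrC.
Qed.

Lemma cvgC_B u v l l' : cvgC u l -> cvgC v l' -> cvgC (fun n => u n - v n) (l - l').
Proof.
move=> ul vl; rewrite -mulN1r.
by apply: cvgC_ext (cvgC_D ul (cvgC_M (-1) vl)) => n; rewrite mulN1r.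
Qed.

Lemma cvgC_cst c : cvgC (fun=> c) c.
Proof. by move=> e e0; exists 0%N => n _; rewrite subrr nrm0. Qed.

Lemma cvgC_sum (I : Type) (r : seq I) (P : pred I) (u : I -> nat -> C) l :
  (forall x, P x -> cvgC (u x) (l x)) ->
  cvgC (fun n => \sum_(x <- r | P x) u x n) (\sum_(x <- r | P x) l x).
Proof.
move=> ul; elim: r => [|x r IH].
  by rewrite big_nil; apply: cvgC_ext (cvgC_cst 0) => n; rewrite big_nil.
rewrite big_cons; case: ifP => Px.
  by apply: cvgC_ext (cvgC_D (ul x Px) IH) => n; rewrite big_cons Px.
by apply: cvgC_ext IH => n; rewrite big_cons Px.
Qed.

Lemma cvgT_D u v l l' : cvgT u l -> cvgT v l' ->
  cvgT (fun n i => u n i + v n i) (fun i => l i + l' i).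
Proof.
move=> ul vl e e0; have [N H] := ul e e0; have [N' H'] := vl e e0.
exists (maxn N N') => n; rewrite geq_max => /andP[Nn N'n] i.
by rewrite opprD addrACA; apply: nrmD_lt (H _ Nn i) (H' _ N'n i).
Qed.

Lemma cvgT_Tmul M g u l : (forall i, nrm (g i) <= M) -> cvgT u l ->
  cvgT (fun n => Tmul g (u n)) (Tmul g l).
Proof.
move=> gM ul e e0; have M0 : 0 <= M := le_trans (nrm_ge0 _) (gM 0%N).
have M1 : 0 < M + 1 by apply: ltr_wpDl.
have [|N H] := ul (e / (M + 1)); first by rewrite divr_gt0.
exists N => n /H{}H i; rewrite -TmulB.
apply: (@le_lt_trans _ _ (M * (e / (M + 1)))); last first.
  by rewrite mulrCA gtr_pMr // ltr_pdivrMr // mul1r ltrDl.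
apply: nrm_sum_le => [|j _]; first by rewrite mulr_ge0 // divr_ge0 ?ltW.
by rewrite nrmM ler_pM ?nrm_ge0 // ltW.
Qed.

Lemma cvgT_mull g M u l : (forall i, nrm (g i) <= M) -> cvgC u l ->
  cvgT (fun n i => u n * g i) (fun i => l * g i).
Proof.
move=> gM ul e e0; have M0 : 0 <= M := le_trans (nrm_ge0 _) (gM 0%N).
have M1 : 0 < M + 1 by apply: ltr_wpDl.
have [|N H] := ul (e / (M + 1)); first by rewrite divr_gt0.
exists N => n /H{}H i; rewrite -mulrBl nrmM.
apply: (@le_lt_trans _ _ (e / (M + 1) * M)).
  by rewrite ler_pM ?nrm_ge0 // ltW.
by rewrite -mulrA gtr_pMr // mulrC ltr_pdivrMr // mul1r ltrDl.
Qed.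

Lemma cvgT_M c u l : cvgT u l -> cvgT (fun n i => c * u n i) (fun i => c * l i).
Proof.
move=> ul e e0; have [->|c0] := eqVneq c 0.
  by exists 0%N => n _ i; rewrite !mul0r subrr nrm0.
have [|N H] := ul (e / nrm c); first by rewrite divr_gt0 ?nrm_gt0.
by exists N => n /H{}H i; rewrite -mulrBr nrmM mulrC -ltr_pdivlMr ?nrm_gt0 ?H.
Qed.

Lemma cvgT_sum (I : Type) (r : seq I) (P : pred I) (u : I -> nat -> nat -> C) l :
  (forall x, P x -> cvgT (u x) (l x)) ->
  cvgT (fun n i => \sum_(x <- r | P x) u x n i) (fun i => \sum_(x <- r | P x) l x i).
Proof.
move=> ul; elim: r => [|x r IH].
  apply: cvgT_ext (cvgT_const (cvgC_cst 0)) => [n i|i]; by rewrite big_nil.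
case Px: (P x).
  by apply: cvgT_ext (cvgT_D (ul x Px) IH) => [n i|i]; rewrite big_cons Px.
by apply: cvgT_ext IH => [n i|i]; rewrite big_cons Px.
Qed.

(** * Absolute values on A *)

Implicit Types a b : {poly F}.

Lemma nrm_embA_lt a b : (size b < size a)%N -> nrm (embA b) < nrm (embA a).
Proof.
move=> ba; have a0 : a != 0 by rewrite -size_poly_gt0 (leq_ltn_trans _ ba).
have [->|b0] := eqVneq b 0; first by rewrite embA0 nrm0 nrm_gt0 embA_eq0.
rewrite !nrm_embA // ltr_eXn2l ?q_gt1 //.
by rewrite -ltnS !prednK ?size_poly_gt0.
Qed.

Lemma nrm_embA_le n a : (size a <= n.+1)%N -> nrm (embA a) <= q%:R ^+ n.
Proof.
have [->|a0] := eqVneq a 0; first by rewrite embA0 nrm0 ltW ?qX_gt0.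
by move=> an; rewrite nrm_embA // ler_weXn2l ?q_ge1 // -ltnS prednK ?size_poly_gt0.
Qed.

Lemma nrm_embA_ge1 a : a != 0 -> 1 <= nrm (embA a).
Proof. by move=> a0; rewrite nrm_embA // exprn_ege1 ?q_ge1. Qed.

Lemma Kinf_embA b : Kinf iota nrm theta (embA b).
Proof.
(* As N is the size of b, [c 0] = 0 and the next values list the coefficients from the leading one
   down. *)
pose N := size b; pose c i := if (i <= N)%N then b`_(N - i) else 0.
exists N, c => e e0; exists N.+1 => n Nn.
rewrite (_ : _ - _ = 0) ?nrm0 //; apply/eqP; rewrite subr_eq0; apply/eqP.
rewrite -(big_mkord predT (fun i => iota (c i) * theta ^- i)) (big_cat_nat (leq0n N.+1) Nn) /=.
rewrite [X in _ + X]big1_seq ?addr0 => [|i]; last first.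
  by rewrite mem_index_iota /c => /andP[_ /andP[Ni _]]; rewrite leqNgt Ni rmorph0 mul0r.
rewrite big_mkord (reindex_inj rev_ord_inj) /=.
rewrite (embA_coef iota theta (leqnSn N)) mulr_suml; apply: eq_bigr => i _.
have iN : (i <= N)%N by rewrite -ltnS.
rewrite subSS /c leq_subr subKn // -mulrA; congr (_ * _).
have tX k : theta ^+ k != 0 by rewrite expf_neq0 ?theta_neq0.
by apply: (canRL (mulfK (tX N))); rewrite -[in X in _ * X](subnK iN) exprD mulKf.
Qed.

(** * Lattice sums *)

Section Lattice.
Variable z : C.
Hypothesis Hz : forall b, 1 <= nrm (z - embA b).

Lemma nrm_z_ge1 : 1 <= nrm z.
Proof. by have := Hz 0; rewrite embA0 subr0. Qed.

(** Divide: b = Qa + R. Then az + b = a(z + Q) + R, where |a(z + Q)| >= |a| > |R|. *)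
Lemma nrm_lattice_l a b : a != 0 -> nrm (embA a) <= nrm (embA a * z + embA b).
Proof.
move=> a0; rewrite [b](divp_eq b a) embAD embAM addrA.
set Q := embA (b %/ a).
have H : nrm (embA a) <= nrm (embA a * z + Q * embA a).
  rewrite [Q * _]mulrC -mulrDr nrmM ler_peMr ?nrm_ge0 //.
  by have := Hz (- (b %/ a)); rewrite embAN opprK.
rewrite addrC nrm_dominant //; apply: lt_le_trans H.
by apply: nrm_embA_lt; rewrite ltn_modp.
Qed.

(** If |az| < |b|, the sum has norm |b|; otherwise |b| <= |a||z| and the previous bound on |a|
    applies. *)
Lemma nrm_lattice_r a b : nrm (embA b) <= nrm z * nrm (embA a * z + embA b).
Proof.
have z1 := nrm_z_ge1; have z0 := lt_le_trans ltr01 z1.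
have [->|a0] := eqVneq a 0; first by rewrite embA0 mul0r add0r ler_peMl ?nrm_ge0.
have [H|H] := ltP (nrm (embA a * z)) (nrm (embA b)).
  by rewrite (nrm_dominant H) ler_peMl ?nrm_ge0.
apply: le_trans H _; rewrite nrmM mulrC ler_wpM2l ?nrm_ge0 //.
exact: nrm_lattice_l.
Qed.

Lemma lattice_neq0 a b : a != 0 -> embA a * z + embA b != 0.
Proof.
move=> a0; rewrite -nrm_gt0; apply: lt_le_trans (nrm_lattice_l b a0).
by rewrite nrm_gt0 embA_eq0.
Qed.

Lemma nrm_expV_le x m : 1 <= nrm x -> (0 < m)%N -> nrm (x ^- m) <= (nrm x)^-1.
Proof.
move=> x1 m0; have x0 := lt_le_trans ltr01 x1; rewrite nrmV nrmX lef_pV2 ?posrE ?exprn_gt0 //.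
by case: m m0 => // m _; rewrite exprS ler_peMr ?exprn_ege1 // ltW.
Qed.

Lemma nrm_lattice_expV_l a b m : a != 0 -> (0 < m)%N ->
  nrm ((embA a * z + embA b) ^- m) <= 1 / q%:R ^+ (size a).-1.
Proof.
move=> a0 m0; have H := nrm_lattice_l b a0; have a1 := nrm_embA_ge1 a0.
have ab1 := le_trans a1 H.
apply: le_trans (nrm_expV_le ab1 m0) _.
by rewrite div1r -nrm_embA // lef_pV2 ?posrE // (lt_le_trans ltr01).
Qed.

Lemma nrm_lattice_expV_r a b m : a != 0 -> b != 0 -> (0 < m)%N ->
  nrm ((embA a * z + embA b) ^- m) <= nrm z / q%:R ^+ (size b).-1.
Proof.
move=> a0 b0 m0; have H := nrm_lattice_l b a0; have a1 := nrm_embA_ge1 a0.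
have ab1 := le_trans a1 H; have ab0 := lt_le_trans ltr01 ab1.
apply: le_trans (nrm_expV_le ab1 m0) _.
rewrite -nrm_embA // ler_pdivlMr ?nrm_gt0 ?embA_eq0 //.
by rewrite ler_pdivrMl // mulrC nrm_lattice_r.
Qed.

(** Truncating an expansion of az after n terms and clearing denominators gives P in A with |theta^n
    a z - theta^N P| < q^n <= |theta^n a|, against the lower bound for lattice points. *)
Lemma Omega_lattice a : a != 0 -> Omega iota nrm theta (embA a * z).
Proof.
move=> a0 [N [c cv]].
have [|n /(_ n (leqnn n))] := cv (1 / q%:R ^+ N); first by rewrite divr_gt0 ?qX_gt0.
pose P : {poly F} := \sum_(i < n) c i *: 'X^(n - i).
have t0 k : theta ^+ k != 0 by rewrite expf_neq0 ?theta_neq0.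
have eX k : embA 'X^k = theta ^+ k.
  by rewrite /Defs.embA map_polyXn hornerXn.
have eP : embA P = theta ^+ n * \sum_(i < n) iota (c i) * theta ^- i.
  rewrite /P (big_morph _ (embAD iota theta) (embA0 iota theta)) mulr_sumr.
  apply: eq_bigr => i _; rewrite embAZ eX mulrCA; congr (_ * _).
  by apply: (canRL (mulfK (t0 i))); rewrite -exprD subnK // ltnW.
rewrite ltr_pdivlMr ?qX_gt0 // -nrm_theta -nrmX -nrmM.
rewrite mulrBl divfK //.
rewrite -(ltr_pM2l (qX_gt0 n)) mulr1 -nrm_theta -nrmX -nrmM mulrBr.
rewrite mulrA -eP nrm_distC mulrA -eX -eX -!embAM -embAN mulrC.
have H : 'X^n * a != 0 by rewrite mulf_neq0 // -size_poly_eq0 size_polyXn.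
rewrite [z * _]mulrC => /(le_lt_trans (nrm_lattice_l _ H)).
by rewrite embAM nrmM gtr_pMr ?nrm_gt0 ?eX // ltNge nrm_embA_ge1.
Qed.

(** * Rows, sums over monic polynomials, and boxes *)

Implicit Type phi : {poly F} -> {poly F} -> nat -> C.

(* [phi a b] is the weight of the pair (a, b): a(t), b(t) or 1 below. *)
Definition row phi m a n i : C :=
  \sum_(f : {ffun 'I_n -> F}) phi a (polyN f) i * (embA a * z + embA (polyN f)) ^- m.

(** Passing from n to n + 1 adds the b of degree exactly n, whose terms are at most |z| / q^n. This
    rate does not depend on a, while the limit itself decays with deg a; the double sums need both
    facts. *)
Lemma row_cvg phi m a : (forall a b i, nrm (phi a b i) <= 1) -> (0 < m)%N -> a != 0 ->
  exists l, [/\ cvgT (row phi m a) l,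
    forall n i, nrm (l i - row phi m a n i) <= nrm z / q%:R ^+ n &
    forall i, nrm (l i) <= 1 / q%:R ^+ (size a).-1].
Proof.
move=> phi1 m0 a0.
have [n i _|l lc lB] := @cvgT_step (row phi m a) 0 (nrm z) (nrm_ge0 z).
  pose H p := phi a p i * (embA a * z + embA p) ^- m.
  rewrite {1}/row (sum_polyN_recr n H) (bigD1 0) //=.
  have -> : \sum_(g : {ffun 'I_n -> F}) H (0 *: 'X^n + polyN g) = row phi m a n i.
    by apply: eq_bigr => g _; rewrite scale0r add0r.
  rewrite addrAC subrr add0r; apply: nrm_sum_le => [|c c0]; first exact: geo_ge0 (nrm_ge0 z).
  apply: nrm_sum_le => [|f _]; first exact: geo_ge0 (nrm_ge0 z).
  have sc : size (c *: 'X^n + polyN f) = n.+1.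
    by rewrite size_polyDl size_scale // size_polyXn // ltnS size_polyN.
  rewrite /H nrmM -[leRHS]mul1r ler_pM ?nrm_ge0 //.
  by apply: le_trans (nrm_lattice_expV_r a0 _ m0) _; rewrite -?size_poly_eq0 sc.
exists l; split=> // [n i|i]; first exact: lB.
rewrite -[l i]subr0; apply: cvgC_le (cvgT_cvgC i lc) _; exists 0%N => n _.
rewrite subr0; apply: nrm_sum_le => [|f _]; first exact: geo_ge0.
by rewrite nrmM -[leRHS]mul1r ler_pM ?nrm_ge0 // nrm_lattice_expV_l.
Qed.

Definition rowlim phi m a : nat -> C := Tlim nrm (row phi m a).

Lemma rowlimP phi m a : (forall a b i, nrm (phi a b i) <= 1) -> (0 < m)%N -> a != 0 ->
  [/\ cvgT (row phi m a) (rowlim phi m a),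
    forall n i, nrm (rowlim phi m a i - row phi m a n i) <= nrm z / q%:R ^+ n &
    forall i, nrm (rowlim phi m a i) <= 1 / q%:R ^+ (size a).-1].
Proof.
move=> phi1 m0 a0; have [l [lc lB l1]] := row_cvg phi1 m0 a0.
have E := TlimE lc; split => [|n i|i]; rewrite /rowlim ?E //.
by apply: cvgT_ext lc.
Qed.

Lemma monic_sum_cvg (h : {poly F} -> nat -> C) :
  (forall a i, a != 0 -> nrm (h a i) <= 1 / q%:R ^+ (size a).-1) ->
  exists S, cvgT (fun n i => \sum_(d < n) \sum_(f : {ffun 'I_d -> F}) h (monicN f) i) S.
Proof.
move=> hB.
have [n i _|l lc _] := @cvgT_step
  (fun n i => \sum_(d < n) \sum_(f : {ffun 'I_d -> F}) h (monicN f) i) 0 1 ler01.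
  rewrite big_ord_recr /= addrAC subrr add0r.
  apply: nrm_sum_le => [|f _]; first exact: geo_ge0.
  by apply: le_trans (hB _ _ (monicN_neq0 f)) _; rewrite size_monicN.
by exists l.
Qed.

Lemma monic_sum_Tlim (h : {poly F} -> nat -> C) :
  (forall a i, a != 0 -> nrm (h a i) <= 1 / q%:R ^+ (size a).-1) ->
  let u n i := \sum_(d < n) \sum_(f : {ffun 'I_d -> F}) h (monicN f) i in
  cvgT u (Tlim nrm u).
Proof.
move=> hB u; have [S uS] := monic_sum_cvg hB.
by apply: cvgT_ext (uS) => // i; rewrite (TlimE uS).
Qed.

Definition monic_rows phi m : nat -> C := Tlim nrm (fun n i =>
  \sum_(d < n) \sum_(f : {ffun 'I_d -> F}) rowlim phi m (monicN f) i).

Lemma monic_rows_cvg phi m : (forall a b i, nrm (phi a b i) <= 1) -> (0 < m)%N ->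
  cvgT (fun n i => \sum_(d < n) \sum_(f : {ffun 'I_d -> F}) rowlim phi m (monicN f) i)
    (monic_rows phi m).
Proof.
move=> phi1 m0; apply: monic_sum_Tlim => a i a0.
by have [] := rowlimP phi1 m0 a0.
Qed.

(** The contribution of the pairs (0, b) with b monic: L(chi_t, m) for the weight b(t), zeta(m) for
    the weight 1. *)
Definition monic_axis phi m : nat -> C := Tlim nrm (fun n i =>
  \sum_(d < n) \sum_(f : {ffun 'I_d -> F}) phi 0 (monicN f) i * embA (monicN f) ^- m).

Lemma monic_axis_cvg phi m : (forall a b i, nrm (phi a b i) <= 1) -> (0 < m)%N ->
  cvgT (fun n i => \sum_(d < n) \sum_(f : {ffun 'I_d -> F})
     phi 0 (monicN f) i * embA (monicN f) ^- m) (monic_axis phi m).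
Proof.
move=> phi1 m0.
apply: (monic_sum_Tlim (h := fun b i => phi 0 b i * embA b ^- m)) => a i a0.
rewrite nrmM -[leRHS]mul1r ler_pM ?nrm_ge0 // div1r -nrm_embA //.
exact: nrm_expV_le (nrm_embA_ge1 a0) m0.
Qed.

(* The summand is constant along the q - 1 = -1 nonzero multiples of a pair
   (a, b), whence the signs. *)
Lemma box_cvg phi m : (forall a b i, nrm (phi a b i) <= 1) -> (0 < m)%N ->
  (forall c a b i, c != 0 -> phi (c *: a) (c *: b) i * iota c ^- m = phi a b i) ->
  cvgT (fun n i => \sum_(f : {ffun 'I_n -> F}) \sum_(g : {ffun 'I_n -> F})
     if (polyN f == 0) && (polyN g == 0) then 0
     else (embA (polyN f) * z + embA (polyN g)) ^- m * phi (polyN f) (polyN g) i)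
   (fun i => - monic_axis phi m i - monic_rows phi m i).
Proof.
move=> phi1 m0 phic.
have homog c a b i : c != 0 -> phi (c *: a) (c *: b) i *
    (embA (c *: a) * z + embA (c *: b)) ^- m = phi a b i * (embA a * z + embA b) ^- m.
  move=> c0; rewrite !embAZ -mulrA -mulrDr exprMn invfM mulrA.
  by rewrite phic.
have boxE n i : \sum_(f : {ffun 'I_n -> F}) \sum_(g : {ffun 'I_n -> F})
     (if (polyN f == 0) && (polyN g == 0) then 0
     else (embA (polyN f) * z + embA (polyN g)) ^- m * phi (polyN f) (polyN g) i)
   = - (\sum_(d < n) \sum_(f : {ffun 'I_d -> F}) phi 0 (monicN f) i * embA (monicN f) ^- m)
     - \sum_(d < n) \sum_(f : {ffun 'I_d -> F}) row phi m (monicN f) n i.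
  transitivity (\sum_(f : {ffun 'I_n -> F}) row phi m (polyN f) n i).
    apply: eq_bigr => f _; apply: eq_bigr => g _; case: ifP => [/andP[/eqP-> /eqP->]|_].
      (* The pair (0, 0) may be included: the convention 0^-1 = 0 gives its term the value 0, as m >
         0. *)
      by rewrite embA0 mul0r addr0 expr0n eqn0Ngt m0 invr0 mulr0.
    by rewrite mulrC.
  rewrite (@sum_polyN_homogeneous C F iota n (fun a => row phi m a n i)); last first.
    move=> c a c0; rewrite /row.
    rewrite (@sum_polyN_scale C F n c (fun b => phi (c *: a) b i * (embA (c *: a) * z + embA b) ^- m) c0).
    by apply: eq_bigr => f _; rewrite homog.
  congr (_ + _); rewrite /row.
  rewrite (@sum_polyN_homogeneous C F iota n
    (fun b => phi 0 b i * (embA 0 * z + embA b) ^- m)); last first.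
    by move=> c b c0; rewrite -(homog c 0 b i c0) scaler0.
  rewrite embA0 mul0r addr0 expr0n eqn0Ngt m0 invr0 mulr0 sub0r; congr (- _).
  by apply: eq_bigr => d _; apply: eq_bigr => f _; rewrite add0r.
apply: (cvgT_ext (fun n i => esym (boxE n i)) (fun=> erefl)).
have N1 := cvgT_M (-1) (monic_axis_cvg phi1 m0).
have N2 := cvgT_M (-1) (monic_rows_cvg phi1 m0).
(* Truncated rows may be replaced by their limits: the error |z| / q^n is uniform in a, and an
   ultrametric sum does not enlarge it. *)
apply: (cvgT_near_geo (B := nrm z) (cvgT_ext _ _ (cvgT_D N1 N2))) => [n i|i|n i].
- by rewrite !mulN1r.
- by rewrite !mulN1r.
rewrite /= opprD !opprK addrACA addNr add0r addrC -sumrB.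
apply: nrm_sum_le => [|d _]; first exact: geo_ge0 (nrm_ge0 z).
rewrite -sumrB; apply: nrm_sum_le => [|f _]; first exact: geo_ge0 (nrm_ge0 z).
by have [_ -> _] := rowlimP phi1 m0 (monicN_neq0 f).
Qed.

Definition phi_one : {poly F} -> {poly F} -> nat -> C := fun _ _ _ => 1.
Definition phi_l : {poly F} -> {poly F} -> nat -> C := fun a _ i => tateA a i.
Definition phi_r : {poly F} -> {poly F} -> nat -> C := fun _ b i => tateA b i.

Lemma nrm_phi_one a b i : nrm (phi_one a b i) <= 1. Proof. by rewrite nrm1. Qed.
Lemma nrm_phi_l a b i : nrm (phi_l a b i) <= 1. Proof. exact: nrm_iota_le1. Qed.
Lemma nrm_phi_r a b i : nrm (phi_r a b i) <= 1. Proof. exact: nrm_iota_le1. Qed.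

(** The two sides differ by the substitution b -> -b. The weight 1 makes the limit independent of
    i. *)
Lemma latsum_rowlim m a i : (0 < m)%N -> a != 0 ->
  latsum iota nrm theta m (embA a * z) = rowlim phi_one m a i.
Proof.
move=> m0 a0; have [rc _ _] := rowlimP nrm_phi_one m0 a0.
apply: ClimE; apply: cvgC_ext (cvgT_cvgC i rc) => n.
rewrite /row (@sum_polyN_scale _ _ n (-1) (fun b => 1 * (embA a * z + embA b) ^- m)).
  by apply: eq_bigr => f _; rewrite mul1r embAZ rmorphN1 mulN1r.
by rewrite oppr_eq0 oner_eq0.
Qed.

End Lattice.

(** * The Carlitz exponential *)

Section CarlitzExponential.
Variables (pit r : C).
Hypothesis r_root : r ^+ (q - 1) = - theta.
Local Notation p n := (r ^+ q * \prod_(1 <= i < n) (1 - theta / theta ^+ (q ^ i))^-1).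
Hypothesis pit_cvg : cvgC (fun n => p n) pit.
Local Notation D := (Dj F theta).
Local Notation rho := (nrm r).

Lemma card_predS : q.-1.+1 = q. Proof. by rewrite prednK // ltnW // card_gt1. Qed.

Lemma rho_exp : rho ^+ q.-1 = q%:R.
Proof. by rewrite -nrmX -subn1 r_root nrmN nrm_theta. Qed.

Lemma rho_gt1 : 1 < rho.
Proof.
rewrite ltNge; apply/negP => r1.
by have := exprn_ile1 q.-1 (nrm_ge0 r) r1; rewrite rho_exp leNgt q_gt1.
Qed.

Lemma rho_gt0 : 0 < rho. Proof. exact: lt_trans rho_gt1. Qed.

Lemma rho_neq0 : rho != 0. Proof. by rewrite gt_eqF ?rho_gt0. Qed.

Lemma rho_le_q : rho <= q%:R.
Proof.
rewrite -rho_exp; have := card_predS; case: q.-1 => [|n _].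
  by move=> q1; have := card_gt1 F; rewrite -q1.
by rewrite exprS ler_peMr ?exprn_ege1 // ltW ?rho_gt0 ?rho_gt1.
Qed.

Lemma card_pow_gt j : (j < q ^ j)%N. Proof. exact: ltn_expl (card_gt1 F). Qed.

Lemma nrm_thetaX n : nrm (theta ^+ n) = q%:R ^+ n.
Proof. by rewrite nrmX nrm_theta. Qed.

Lemma nrm_p n : nrm (p n) = rho ^+ q.
Proof.
rewrite nrmM nrmX nrm_prod big1_seq ?mulr1 // => i.
rewrite mem_index_iota => /andP[_ /andP[i1 _]].
rewrite nrmV addrC nrm_dominant ?nrm1 ?invr1 // nrmN nrmM nrmV nrm_theta nrm_thetaX.
rewrite ltr_pdivrMr ?qX_gt0 // mul1r -{1}[q%:R]expr1 ltr_eXn2l ?q_gt1 //.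
exact: leq_ltn_trans i1 (card_pow_gt i).
Qed.

Lemma nrm_pit : nrm pit = rho ^+ q.
Proof.
have e0 : 0 < rho ^+ q by rewrite exprn_gt0 ?rho_gt0.
have [N /(_ N (leqnn N))] := pit_cvg e0.
rewrite -{1}(nrm_p N) nrm_distC => H.
by rewrite -(nrm_p N) -(nrm_dominant H) subrK.
Qed.

Lemma pit_neq0 : pit != 0.
Proof. by rewrite -nrm_gt0 nrm_pit exprn_gt0 ?rho_gt0. Qed.

Lemma nrm_D j : nrm (D j) = q%:R ^+ (j * q ^ j).
Proof.
rewrite nrm_prod (eq_bigr (fun=> q%:R ^+ (q ^ j))) => [|i _].
  by rewrite prodr_const card_ord -exprM mulnC.
rewrite addrC nrm_dominant ?nrm_thetaX // nrmN !nrm_thetaX.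
by rewrite ltr_eXn2l ?q_gt1 // ltn_exp2l ?card_gt1.
Qed.

Lemma D_recr j : D j.+1 = (theta ^+ (q ^ j.+1) - theta) * D j ^+ q.
Proof.
rewrite /Dj /qq big_ord_recl expn0 expr1; congr (_ * _).
rewrite -prodrXl; apply: eq_bigr => i _.
by rewrite (frob1B iota) -!exprM -!expnSr.
Qed.

Lemma thetaX_sub_neq0 i j : (i < j)%N -> theta ^+ (q ^ j) - theta ^+ (q ^ i) != 0.
Proof.
move=> ij; rewrite -nrm_gt0 addrC nrm_dominant ?nrm_thetaX ?qX_gt0 //.
by rewrite nrmN !nrm_thetaX ltr_eXn2l ?q_gt1 // ltn_exp2l ?card_gt1.
Qed.

Lemma theta_sub_neq0 d : theta ^+ (q ^ d.+1) - theta != 0.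
Proof. by have := @thetaX_sub_neq0 0 d.+1 isT; rewrite expn0 expr1. Qed.

(** The coefficient of X^(q^d) in the Carlitz logarithm log_C. *)
Definition logcoef d : C := \prod_(1 <= m < d.+1) (theta - theta ^+ (q ^ m))^-1.

Lemma logcoef_recr d : (theta - theta ^+ (q ^ d.+1)) * logcoef d.+1 = logcoef d.
Proof.
rewrite /logcoef big_nat_recr //= mulrCA divff ?mulr1 //.
by rewrite -oppr_eq0 opprB theta_sub_neq0.
Qed.

Definition exp_log_coef d : C := \sum_(i < d.+1) (D i)^-1 * logcoef (d - i) ^+ (q ^ i).

(** The composite f = exp_C o log_C satisfies f(theta X + X^q) = theta f(X) + f(X)^q; this is the
    comparison of coefficients of X^(q^(d+1)). *)
Lemma exp_log_coef_recr d : (theta ^+ (q ^ d.+1) - theta) * exp_log_coef d.+1 =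
  exp_log_coef d ^+ q - exp_log_coef d.
Proof.
rewrite /exp_log_coef mulr_sumr.
(* Split the factor at theta^(q^i): the first part is absorbed by the recursion of D_i, the second
   by that of [logcoef]. *)
rewrite (eq_bigr (fun i : 'I_d.+2 =>
   (theta ^+ (q ^ i) - theta) * ((D i)^-1 * logcoef (d.+1 - i) ^+ (q ^ i)) +
   (theta ^+ (q ^ d.+1) - theta ^+ (q ^ i)) * ((D i)^-1 * logcoef (d.+1 - i) ^+ (q ^ i)))).
  2: by move=> i _; rewrite -mulrDl [X in _ = X * _]addrC addrA subrK.
rewrite big_split /=; congr (_ + _).
  rewrite big_ord_recl expn0 expr1 subrr mul0r add0r (frob1_sum iota).
  apply: eq_bigr => i _; rewrite lift0 D_recr subSS invfM exprMn exprVn.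
  rewrite -exprM -expnSr !mulrA divff ?mul1r //.
  exact: theta_sub_neq0.
rewrite big_ord_recr /= subrr mul0r addr0 -sumrN; apply: eq_bigr => i _.
have id : (i <= d)%N by rewrite -ltnS.
rewrite mulrCA -mulrN; congr (_ * _).
rewrite subSn // -[in RHS](frobN iota) -(logcoef_recr (d - i)) -mulNr opprB exprMn.
by congr (_ * _); rewrite (frobB iota) -exprM -expnD addSn subnK.
Qed.

(* Coefficient of X^(q^(d+1)) in exp_C (log_C X) = X. *)
Lemma exp_log_coef_eq0 d : exp_log_coef d.+1 = 0.
Proof.
(* A coefficient fixed by x -> x^q forces the next one to vanish; the coefficient 1 at d = 0 starts
   the induction. *)
have H e : exp_log_coef e ^+ q = exp_log_coef e -> exp_log_coef e.+1 = 0.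
  move=> E; have := exp_log_coef_recr e; rewrite E subrr => /eqP.
  rewrite mulf_eq0 => /orP[|/eqP//].
  by rewrite (negPf (theta_sub_neq0 e)).
elim: d => [|d IH]; apply: H; last by have := exp0_card_pow C F 1; rewrite expn1 IH.
rewrite /exp_log_coef big_ord1 /Dj big_ord0 subnn /logcoef big_geq //.
by rewrite expr1n mulr1 invr1 expr1n.
Qed.

Lemma p_logcoef d : p d.+1 = logcoef d * r ^+ (q ^ d.+1).
Proof.
elim: d => [|d IH]; first by rewrite /logcoef !big_geq // mulr1 mul1r expn1.
rewrite big_nat_recr //= mulrA IH -(logcoef_recr d).
set T := theta ^+ _; have T0 : T != 0 by rewrite expf_neq0 ?theta_neq0.
have tT : theta - T != 0.
  by rewrite -oppr_eq0 opprB theta_sub_neq0.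
(* Raise r^(q-1) = -theta to the power q^(d+1). *)
have -> : r ^+ (q ^ d.+2) = - T * r ^+ (q ^ d.+1).
  rewrite expnS -{1}card_predS mulSn exprD mulrC exprM -subn1 r_root.
  by rewrite (frobN iota).
have -> : 1 - theta / T = (theta - T) / - T by rewrite invrN mulrN mulrBl divff ?opprB.
by rewrite invf_div; field.
Qed.

(** Multiplying the vanishing coefficient of exp_C o log_C by r^(q^(d+2)) turns the powers of
    [logcoef] into powers of partial products. *)
Lemma sum_p_eq0 d : \sum_(i < d.+2) (D i)^-1 * p (d.+2 - i) ^+ (q ^ i) = 0.
Proof.
have := congr1 ( *%R (r ^+ (q ^ d.+2))) (exp_log_coef_eq0 d).
rewrite mulr0 => {2}<-; rewrite mulr_sumr; apply: eq_bigr => i _.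
have id : (i <= d.+1)%N by rewrite -ltnS.
rewrite subSn // p_logcoef exprMn [in RHS]mulrCA; congr (_ * _).
by rewrite mulrC -exprM -expnD addSn subnK.
Qed.

(** * Convergence and zeros of the exponential *)

Definition expterm j x : C := (D j)^-1 * x ^+ (q ^ j).

Lemma nrm_expterm j x : nrm (expterm j x) = (nrm x / q%:R ^+ j) ^+ (q ^ j).
Proof.
by rewrite nrmM nrmV nrmX nrm_D exprMn exprVn -exprM mulrC.
Qed.

Lemma expterm_small B : 0 <= B -> exists N, forall j x, (N <= j)%N -> nrm x <= B ->
  nrm (expterm j x) <= 1 / q%:R ^+ j.
Proof.
move=> B0; have [|N H] := @geo_small B q%:R^-1; first by rewrite invr_gt0 q_gt0.
exists N => j x Nj xB; rewrite nrm_expterm div1r.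
have Hx : nrm x / q%:R ^+ j <= q%:R^-1.
  apply: le_trans (ltW (H j Nj)); apply: ler_wpM2r => //.
  by rewrite invr_ge0 ltW ?qX_gt0.
apply: le_trans (lerXn2r (q ^ j) _ _ Hx) _; rewrite ?nnegrE ?geo_ge0 ?nrm_ge0 //.
  by rewrite invr_ge0 ltW ?q_gt0.
rewrite exprVn lef_pV2 ?posrE ?qX_gt0 // ler_weXn2l ?q_ge1 //.
exact: ltnW (card_pow_gt j).
Qed.

Definition expsum y n : C := \sum_(j < n) expterm j (pit * y).

Lemma expsum_cvgT (y : nat -> C) B : (forall i, nrm (y i) <= B) ->
  exists l, cvgT (fun n i => expsum (y i) n) l.
Proof.
move=> yB; have B0 : 0 <= B := le_trans (nrm_ge0 _) (yB 0%N).
have [N H] := expterm_small (mulr_ge0 (nrm_ge0 pit) B0).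
have [n i Nn|l lc _] := @cvgT_step (fun n i => expsum (y i) n) N 1 ler01.
  rewrite /expsum big_ord_recr /= addrAC subrr add0r; apply: H => //.
  by rewrite nrmM ler_wpM2l ?nrm_ge0.
by exists l.
Qed.

(** The exponential rescaled by the period, y -> exp_C(pit y), so that its zeros include A. *)
Definition cexp y : C := Clim nrm (expsum y).

Lemma cexp_cvg y : cvgC (expsum y) (cexp y).
Proof.
have [l lc] := @expsum_cvgT (fun=> y) (nrm y) (fun=> lexx _).
by have /ClimE E := cvgT_cvgC 0 lc; rewrite /cexp E; apply: cvgT_cvgC 0%N lc.
Qed.

Lemma cexp_cvgT (y : nat -> C) B : (forall i, nrm (y i) <= B) ->
  cvgT (fun n i => expsum (y i) n) (fun i => cexp (y i)).
Proof.
move=> yB; have [l lc] := expsum_cvgT yB; apply: cvgT_ext (lc) => // i.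
by have /ClimE := cvgT_cvgC i lc.
Qed.

Lemma cexpD x y : cexp (x + y) = cexp x + cexp y.
Proof.
apply: cvgC_unique (cexp_cvg _) _; apply: cvgC_ext (cvgC_D (cexp_cvg x) (cexp_cvg y)) => n.
rewrite /expsum -big_split; apply: eq_bigr => j _.
by rewrite /expterm /= -mulrDr -(frobD iota) -mulrDr.
Qed.

Lemma cexp_iota c y : cexp (iota c * y) = iota c * cexp y.
Proof.
apply: cvgC_unique (cexp_cvg _) _; apply: cvgC_ext (cvgC_M (iota c) (cexp_cvg y)) => n.
rewrite /expsum mulr_sumr; apply: eq_bigr => j _.
by rewrite /expterm mulrCA (mulrCA pit) [in RHS]exprMn frob_iota.
Qed.

Lemma nrm_expX_small x (e : R) n : (0 < n)%N -> nrm x < Num.min 1 e -> nrm x ^+ n < e.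
Proof.
rewrite lt_min => n0 /andP[x1]; apply: le_lt_trans.
by case: n n0 => // n _; rewrite exprS ler_piMr ?nrm_ge0 // exprn_ile1 ?nrm_ge0 // ltW.
Qed.

Lemma card_pow_gt0 j : (0 < q ^ j)%N. Proof. exact: leq_ltn_trans (card_pow_gt j). Qed.

(** Subtracting the vanishing combination of partial products leaves the terms of exp_C at the
    differences pit - p_(d+2-i), which tend to 0 together. *)
Lemma cexp1 : cexp 1 = 0.
Proof.
apply: cvgC_unique (cexp_cvg _) _ => e e0.
have [N1 H1] := expterm_small (exprn_ge0 q (nrm_ge0 r)).
have [N2 H2] := geo_small 1 e0.
have me : 0 < Num.min 1 e by rewrite lt_min ltr01.
have [M HM] := pit_cvg me.
exists (maxn N1 N2 + M + 2)%N => n nM; rewrite subr0.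
have [d En] : exists d, n = d.+2 by exists (n - 2)%N; lia.
rewrite En in nM *.
have -> : expsum 1 d.+2 = \sum_(i < d.+2) expterm i (pit - p (d.+2 - i)).
  apply/eqP; rewrite -subr_eq0 -[X in _ == X](sum_p_eq0 d) -sumrB; apply/eqP.
  by apply: eq_bigr => i _; rewrite /expterm -mulrBr (frobB iota) mulr1 subKr.
apply: (big_ind (fun x => nrm x < e)) => [|x y|i _]; rewrite ?nrm0 //.
  exact: nrmD_lt.
(* For large i the term is small because both pit and p have norm rho^q; for small i the index d + 2
   - i exceeds M, so pit - p is small. *)
have [Ni|iN] := leqP (maxn N1 N2) i.
  move: Ni; rewrite geq_max => /andP[N1i N2i].
  apply: le_lt_trans (H1 _ _ N1i _) (H2 _ N2i).
  by rewrite nrmB_le // ?nrm_pit // nrm_p.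
rewrite nrmM; apply: (@le_lt_trans _ _ (1 * nrm ((pit - p (d.+2 - i)) ^+ (q ^ i)))).
  apply: ler_wpM2r; first exact: nrm_ge0.
  by rewrite nrmV nrm_D invf_le1 ?qX_gt0 // exprn_ege1 ?q_ge1.
rewrite mul1r nrmX; apply: nrm_expX_small; first exact: card_pow_gt0.
rewrite nrm_distC; apply: HM; move: nM iN; lia.
Qed.

(** This follows from exp_C(theta x) = theta exp_C(x) + exp_C(x)^q. On partial sums Frobenius moves
    the j-th term to index j + 1, hence the shift between n and n + 1. *)
Lemma cexp_theta y : cexp y = 0 -> cexp (theta * y) = 0.
Proof.
move=> y0; apply: cvgC_unique (cexp_cvg _) _; apply: cvgC_shift.
have Ey := cexp_cvg y; rewrite y0 in Ey.
have E n : expsum (theta * y) n.+1 = theta * expsum y n.+1 + expsum y n ^+ q.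
  rewrite /expsum (frob1_sum iota) !big_ord_recl mulrDr -addrA.
  congr (_ + _).
    by rewrite /expterm expn0 !expr1 [in RHS]mulrCA (mulrCA pit).
  rewrite mulr_sumr -big_split; apply: eq_bigr => j _ /=.
  rewrite /expterm /bump leq0n add1n (mulrCA pit) exprMn.
  have -> : ((D j)^-1 * (pit * y) ^+ (q ^ j)) ^+ q =
      (theta ^+ (q ^ j.+1) - theta) * ((D j.+1)^-1 * (pit * y) ^+ (q ^ j.+1)).
    rewrite D_recr invfM exprMn exprVn -exprM -expnSr !mulrA divff ?mul1r //.
    exact: theta_sub_neq0.
  by rewrite -mulrDl addrC subrK mulrCA.
move=> e e0; have me : 0 < Num.min 1 e by rewrite lt_min ltr01.
have [N1 H1] := cvgC_M theta Ey e0; have [N2 H2] := Ey _ me.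
exists (maxn N1 N2) => n; rewrite geq_max => /andP[N1n N2n].
rewrite subr0 E; apply: nrmD_lt.
  by have := H1 n.+1 (leqW N1n); rewrite mulr0 subr0.
rewrite nrmX; apply: nrm_expX_small; first exact: ltnW (card_gt1 F).
by have := H2 n N2n; rewrite subr0.
Qed.

Lemma cexp_embA b : cexp (embA b) = 0.
Proof.
have c0 : cexp 0 = 0 by have := cexp_iota 0 1; rewrite rmorph0 !mul0r.
elim/poly_ind: b => [|b c IH]; first by rewrite embA0 c0.
rewrite embAD embAM embAX embAC cexpD mulrC cexp_theta // add0r.
by rewrite -[iota c]mulr1 cexp_iota cexp1 mulr0.
Qed.

(** * The series omega and chi_t *)

Local Notation omega := (omega F nrm theta pit).
Local Notation chi_t := (chi_t F nrm theta pit).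

Definition cexp_series w : nat -> C := fun i => cexp (w / theta ^+ i.+1).

Lemma expterm_inv_ct j w i : expterm j (pit * (w / theta ^+ i.+1)) =
  pit ^+ (q ^ j) * w ^+ (q ^ j) / D j * inv_ct (theta ^+ (q ^ j)) i.
Proof.
rewrite /expterm /inv_ct mulrA !exprMn exprVn -!exprM [(i.+1 * _)%N]mulnC.
by rewrite mulrC -!mulrA; congr (_ * (_ * _)); rewrite mulrC.
Qed.

Lemma cexp_series_cvgT w : cvgT (fun n i => \sum_(j < n)
   pit ^+ (q ^ j) * w ^+ (q ^ j) / D j * inv_ct (theta ^+ (q ^ j)) i) (cexp_series w).
Proof.
have yB i : nrm (w / theta ^+ i.+1) <= nrm w.
  rewrite nrmM nrmV nrm_thetaX ler_piMr ?nrm_ge0 //.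
  by rewrite invf_le1 ?qX_gt0 // exprn_ege1 ?q_ge1.
apply: cvgT_ext (cexp_cvgT yB) => // n i; apply: eq_bigr => j _.
exact: expterm_inv_ct.
Qed.

Lemma omegaE : omega =1 cexp_series 1.
Proof.
apply: TlimE; apply: cvgT_ext (cexp_series_cvgT 1) => // n i.
by apply: eq_bigr => j _; rewrite expr1n mulr1.
Qed.

Lemma chi_tE w i : chi_t w i = Tmul (Tinv omega) (cexp_series w) i.
Proof. by apply: eq_Tmul => // j; apply: (TlimE (cexp_series_cvgT w)). Qed.

(* The part of b / theta^(i+1) lying in A is killed by the exponential. *)
Lemma cexp_series_shift w b i :
  cexp_series (w + embA b) i = cexp_series w i + Tmul (tateA b) omega i.
Proof.
rewrite /cexp_series mulrDl cexpD; congr (_ + _).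
have t0 k : theta ^+ k != 0 by rewrite expf_neq0 ?theta_neq0.
have eX k : embA 'X^k = theta ^+ k by rewrite /Defs.embA map_polyXn hornerXn.
rewrite -{1}(poly_take_drop i.+1 b) embAD embAM eX mulrDl mulfK // cexpD cexp_embA addr0.
rewrite (embA_coef iota theta (size_take_poly i.+1 b)) mulr_suml.
rewrite (big_morph cexp cexpD (id1 := 0)); last first.
  by have := cexp_embA 0; rewrite embA0.
apply: eq_bigr => j _; rewrite coef_take_poly ltn_ord -mulrA cexp_iota omegaE.
have ji : (j <= i)%N by rewrite -ltnS.
congr (_ * cexp _); rewrite mul1r; apply: (canLR (mulfK (t0 _))).
by rewrite -[X in _ * theta ^+ X.+1](subnK ji) -addSn exprD mulKf.
Qed.

Lemma nrm_pit_theta i : nrm (pit / theta ^+ i.+1) = rho / q%:R ^+ i.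
Proof.
rewrite nrmM nrm_pit nrmV nrm_thetaX -card_predS !exprS rho_exp card_predS.
by rewrite invfM mulrA mulfK ?gt_eqF ?q_gt0.
Qed.

Lemma nrm_pit_theta_le i : nrm (pit / theta ^+ i.+1) <= rho.
Proof.
rewrite nrm_pit_theta ler_pdivrMr ?qX_gt0 // ler_peMr ?(ltW rho_gt0) //.
by rewrite exprn_ege1 ?q_ge1.
Qed.

(** Subtracting removes the term j = 0 of the exponential; the others have norm at most 1, since rho
    <= q <= q^j for j >= 1. *)
Lemma nrm_cexp_series1 i :
  nrm (cexp_series 1 i - pit / theta ^+ i.+1) <= 1.
Proof.
rewrite /cexp_series mul1r; set y := theta ^- i.+1.
have ny : nrm (pit * y) <= rho := nrm_pit_theta_le i.
apply: cvgC_le (cexp_cvg y) _; exists 1%N => -[//|n] _.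
rewrite /expsum big_ord_recl {1}/expterm /Dj big_ord0 invr1 mul1r expn0 expr1.
rewrite addrAC subrr add0r; apply: nrm_sum_le => // j _; rewrite nrm_expterm.
apply: exprn_ile1; first by rewrite geo_ge0 ?nrm_ge0.
rewrite ler_pdivrMr ?qX_gt0 // mul1r (le_trans ny) // (le_trans rho_le_q) //.
by rewrite -{1}[q%:R]expr1 ler_weXn2l ?q_ge1.
Qed.

Lemma nrm_omega0 : nrm (omega 0%N) = rho.
Proof.
rewrite omegaE -[cexp_series _ _](subrK (pit / theta ^+ 1)) nrm_dominant.
  by rewrite nrm_pit_theta expr0 divr1.
rewrite nrm_pit_theta expr0 divr1.
exact: le_lt_trans (nrm_cexp_series1 0) rho_gt1.
Qed.

Lemma nrm_omega_le i : nrm (omega i) <= rho.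
Proof.
rewrite omegaE -[cexp_series _ _](subrK (pit / theta ^+ i.+1)) nrmD_le //.
  exact: le_trans (nrm_cexp_series1 i) (ltW rho_gt1).
exact: nrm_pit_theta_le.
Qed.

Lemma Tmul_omega_inv : Tmul omega (Tinv omega) = Tone C.
Proof. by apply: Tmul_TinvE; rewrite -nrm_gt0 nrm_omega0 rho_gt0. Qed.

(** In the recursion for 1/omega no coefficient of omega exceeds the constant one in norm, so the
    bound propagates. Bounded coefficients make multiplication by 1/omega continuous for the Gauss
    norm. *)
Lemma nrm_Tinv_omega_le i : nrm (Tinv omega i) <= rho^-1.
Proof.
have rV0 : 0 <= rho^-1 by rewrite invr_ge0 ltW ?rho_gt0.
elim/ltn_ind: i => i IH.
have := congr1 (fun f => f i) Tmul_omega_inv; rewrite /Tmul big_ord_recl subn0.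
move=> /(canRL (addrK _)) E.
have : nrm (omega 0%N * Tinv omega i) <= 1.
  rewrite E; apply: nrmB_le; first by rewrite /Tone; case: ifP; rewrite ?nrm1 ?nrm0.
  apply: nrm_sum_le => // j _; rewrite nrmM -(divff rho_neq0).
  by rewrite ler_pM ?nrm_ge0 ?nrm_omega_le // IH // lift0 ltn_subrL (leq_ltn_trans _ (ltn_ord j)).
by rewrite nrmM nrm_omega0 -ler_pdivlMl ?rho_gt0 // mulr1.
Qed.

Lemma Tinv_omegaK f i : Tmul (Tinv omega) (Tmul f omega) i = f i.
Proof.
rewrite TmulC -TmulA Tmul_omega_inv TmulC.
exact: Tmul1.
Qed.

(** The coefficient of t^i w^(q^j) in omega chi_t(w). *)
Definition alpha j i : C := expterm j (pit / theta ^+ i.+1).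

Lemma alphaE j i : alpha j i = pit ^+ (q ^ j) / D j * inv_ct (theta ^+ (q ^ j)) i.
Proof. by have := expterm_inv_ct j 1 i; rewrite expr1n mulr1 div1r. Qed.

Lemma expterm_alpha j x i :
  expterm j (pit * (x / theta ^+ i.+1)) = alpha j i * x ^+ (q ^ j).
Proof. by rewrite /alpha /expterm -mulrA -exprMn mulrA mulrAC. Qed.

Lemma nrm_alpha_le j i : nrm (alpha j i) <= (rho / q%:R ^+ j) ^+ (q ^ j).
Proof.
rewrite nrm_expterm lerXn2r ?nnegrE ?geo_ge0 ?nrm_ge0 //.
by rewrite ler_wpM2r ?nrm_pit_theta_le // invr_ge0 ltW ?qX_gt0.
Qed.

(** * The sum over a single row *)

Section KeyLimit.
Variables (z : C) (k : nat) (a : {poly F}).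
Hypotheses (Hz : forall b, 1 <= nrm (z - embA b)) (k0 : (0 < k)%N) (a0 : a != 0).
Local Notation w := (embA a * z).

(* Expanding the exponential series, the power sums over A of exponent q^j - k
   vanish for k <= q^j and j < n, and the terms with j >= n are small. *)
Lemma exp_row_near n i : (k <= n)%N -> nrm w <= q%:R ^+ n ->
  nrm (\sum_(f : {ffun 'I_n.+1 -> F})
         cexp_series (w + embA (polyN f)) i * (w + embA (polyN f)) ^- k
       - \sum_(l < k | (q ^ l < k)%N) alpha l i * row z phi_one (k - q ^ l) a n.+1 i)
  <= 1 / q%:R ^+ n.
Proof.
move=> kn wn; pose X (f : {ffun 'I_n.+1 -> F}) := w + embA (polyN f).
have X0 f : X f != 0 by apply: lattice_neq0.
have Xn f : nrm (X f) <= q%:R ^+ n.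
  by rewrite nrmD_le // nrm_embA_le // size_polyN.
pose T j := alpha j i * \sum_f X f ^+ (q ^ j) / X f ^+ k.
(* The box is finite, so the exponential series may be exchanged with the sum over b. *)
have cv : cvgC (fun M => \sum_(j < M) T j)
   (\sum_(f : {ffun 'I_n.+1 -> F}) cexp_series (X f) i * X f ^- k).
  have c f : cvgC (fun M => X f ^- k * expsum (X f / theta ^+ i.+1) M)
     (X f ^- k * cexp_series (X f) i) by apply: cvgC_M; apply: cexp_cvg.
  have := cvgC_sum (index_enum _) (P := predT) (fun f _ => c f).
  under [X in cvgC _ X]eq_bigr do rewrite mulrC.
  apply: cvgC_ext => M; under eq_bigr do rewrite mulr_sumr.
  rewrite exchange_big; apply: eq_bigr => j _ /=; rewrite /T mulr_sumr.
  by apply: eq_bigr => f _; rewrite expterm_alpha mulrC mulrA.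
apply: cvgC_le cv _; exists n => M nM.
rewrite (bigID (fun j : 'I_M => (q ^ j < k)%N)) /=.
have -> : \sum_(j < M | (q ^ j < k)%N) T j =
    \sum_(l < k | (q ^ l < k)%N) alpha l i * row z phi_one (k - q ^ l) a n.+1 i.
  (* As q^l < k forces l < k <= M, both index ranges select the same l. *)
  rewrite (big_ord_widen_cond M (fun l => (q ^ l < k)%N) (fun l =>
    alpha l i * row z phi_one (k - q ^ l) a n.+1 i)) ?(leq_trans kn nM) //.
  apply: eq_big => [j|j jk].
    by case: ltnP => //= jk; rewrite (ltn_trans (card_pow_gt j) jk).
  congr (_ * _); apply: eq_bigr => f _; rewrite /phi_one mul1r.
  apply: (canLR (mulfK (expf_neq0 _ (X0 f)))).
  by rewrite -[X in _ * _ ^+ X](subnK (ltnW jk)) exprD mulKf ?expf_neq0 ?X0.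
rewrite addrAC subrr add0r; apply: nrm_sum_le => [|j]; first exact: geo_ge0.
rewrite -leqNgt => kj.
have TE : T j = alpha j i * \sum_f X f ^+ (q ^ j - k).
  congr (_ * _); apply: eq_bigr => f _.
  by rewrite -{1}(subnK kj) exprD mulfK ?expf_neq0 ?X0.
rewrite TE; have [jn|nj] := leqP j n.
  rewrite (@sum_polyN_addpow _ _ iota theta n.+1 j) ?mulr0 ?nrm0 ?geo_ge0 //.
  by rewrite ltn_subrL k0 card_pow_gt0.
(* For j > n the total is at most (rho q^n / q^j)^(q^j) / q^(nk), where rho q^n <= q^(n+1) <= q^j
   and k >= 1. *)
rewrite nrmM; apply: (@le_trans _ _ ((rho / q%:R ^+ j) ^+ (q ^ j) * (q%:R ^+ n) ^+ (q ^ j - k))).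
  apply: ler_pM; rewrite ?nrm_ge0 ?nrm_alpha_le //.
  apply: nrm_sum_le => [|f _]; first by rewrite exprn_ge0 // ltW ?qX_gt0.
  by rewrite nrmX lerXn2r ?nnegrE ?nrm_ge0 // ltW ?qX_gt0.
rewrite expfB_cond; last by rewrite gt_eqF ?qX_gt0.
rewrite mulrA -exprMn; apply: ler_pM; rewrite ?exprn_ge0 ?invr_ge0 ?mulr_ge0 //.
- by rewrite ltW ?rho_gt0.
- by rewrite invr_ge0 ltW ?qX_gt0.
- by rewrite ltW ?qX_gt0.
- by rewrite exprn_ge0 // ltW ?qX_gt0.
- apply: exprn_ile1.
    by rewrite mulr_ge0 ?geo_ge0 ?(ltW rho_gt0) // ltW ?qX_gt0.
  rewrite mulrAC ler_pdivrMr ?qX_gt0 // mul1r.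
  apply: (@le_trans _ _ (q%:R * q%:R ^+ n)).
    by rewrite ler_wpM2r ?rho_le_q // ltW ?qX_gt0.
  by rewrite -exprS ler_weXn2l ?q_ge1.
rewrite lef_pV2 ?posrE ?exprn_gt0 ?q_gt0 //.
case: k k0 => // k' _; rewrite exprS ler_peMr ?(ltW (qX_gt0 n)) //.
by rewrite !exprn_ege1 ?q_ge1.
Qed.

Lemma exp_row_cvg i : cvgC (fun n => \sum_(f : {ffun 'I_n -> F})
     cexp_series (w + embA (polyN f)) i * (w + embA (polyN f)) ^- k)
   (\sum_(l < k | (q ^ l < k)%N) alpha l i * latsum iota nrm theta (k - q ^ l) w).
Proof.
have cl : cvgC (fun n => \sum_(l < k | (q ^ l < k)%N)
    alpha l i * row z phi_one (k - q ^ l) a n i)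
   (\sum_(l < k | (q ^ l < k)%N) alpha l i * latsum iota nrm theta (k - q ^ l) w).
  apply: cvgC_sum => l lk; have kl : (0 < k - q ^ l)%N by rewrite subn_gt0.
  rewrite (latsum_rowlim Hz i kl a0); apply: cvgC_M; apply: cvgT_cvgC.
  by have [] := rowlimP Hz nrm_phi_one kl a0.
have [N H] := geo_small (nrm w) ltr01.
(* From N on, |w| <= q^n. The constant q rewrites the error 1 / q^n of truncation n + 1 as q /
   q^(n+1). *)
apply: (cvgC_near_geo (N := (maxn k N).+1) (B := q%:R) cl) => -[//|n].
rewrite ltnS geq_max => /andP[kn Nn].
rewrite exprS invfM mulrA divff ?gt_eqF ?q_gt0 //.
apply: exp_row_near kn _; have := H n Nn.
by rewrite ltr_pdivrMr ?qX_gt0 // mul1r => /ltW.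
Qed.

(** Write b(t) = chi_t(w + b) - chi_t(w) in each truncated row: the first part is 1/omega times the
    exponential row, whose limit is known, and the second is a multiple of the plain lattice sum. *)
Lemma rowlim_phi_r i : rowlim z phi_r k a i =
  Tmul (Tinv omega) (fun j => \sum_(l < k | (q ^ l < k)%N)
     alpha l j * latsum iota nrm theta (k - q ^ l) w) i
  - chi_t w i * latsum iota nrm theta k w.
Proof.
have [rc _ _] := rowlimP Hz nrm_phi_r k0 a0.
have [r1 _ _] := rowlimP Hz nrm_phi_one k0 a0.
apply: cvgC_unique (cvgT_cvgC i rc) _.
pose Y n j := \sum_(f : {ffun 'I_n -> F})
     cexp_series (w + embA (polyN f)) j * (w + embA (polyN f)) ^- k.
have YE n : row z phi_r k a n i =
    Tmul (Tinv omega) (Y n) i - chi_t w i * row z phi_one k a n i.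
  rewrite Tmul_sum /row mulr_sumr -sumrB; apply: eq_bigr => f _.
  set x := w + embA _.
  have -> : Tmul (Tinv omega) (fun j => cexp_series x j * x ^- k) i =
     x ^- k * (chi_t w i + tateA (polyN f) i).
    rewrite -[X in _ = _ * (_ + X)](Tinv_omegaK (tateA (polyN f))) chi_tE.
    rewrite /Tmul -big_split mulr_sumr /=; apply: eq_bigr => j _.
    by rewrite -mulrDr -cexp_series_shift mulrA mulrC.
  rewrite /phi_one mul1r mulrDr [chi_t w i * _]mulrC addrAC subrr add0r.
  by rewrite mulrC.
apply: (cvgC_ext (fun n => esym (YE n))); apply: cvgC_B; last first.
  by rewrite (latsum_rowlim Hz i k0 a0); apply: cvgC_M; apply: cvgT_cvgC.
(* One coefficient of a product involves finitely many coefficients, so convergence in each of them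
   is enough. *)
apply: cvgC_sum => j _; apply: cvgC_M; exact: exp_row_cvg.
Qed.

Lemma rowlim_phi_l i : rowlim z phi_l k a i = tateA a i * latsum iota nrm theta k w.
Proof.
have [rc _ _] := rowlimP Hz nrm_phi_l k0 a0.
have [r1 _ _] := rowlimP Hz nrm_phi_one k0 a0.
apply: cvgC_unique (cvgT_cvgC i rc) _.
rewrite (latsum_rowlim Hz i k0 a0).
apply: cvgC_ext (cvgC_M _ (cvgT_cvgC i r1)) => n.
by rewrite /row mulr_sumr; apply: eq_bigr => f _; rewrite mul1r.
Qed.

End KeyLimit.

(** * Eisenstein series *)

Section Eisenstein.
Variables (z : C) (k : nat) (G : nat -> {poly C}).
Hypothesis Hz : forall b, 1 <= nrm (z - embA b).
Hypotheses (k0 : (0 < k)%N) (hk : k = 1 %[mod q - 1]).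
Hypothesis HG : is_goss iota nrm theta pit G.

Lemma iota_expV_dvd c m : c != 0 -> (q.-1 %| m)%N -> iota c ^- m = 1.
Proof.
by move=> c0 /dvdnP[j ->]; rewrite mulnC exprM iota_exp_pred // expr1n invr1.
Qed.

Lemma dvd_pred_k : (q.-1 %| k - 1)%N.
Proof. by rewrite -eqn_mod_dvd // -subn1; apply/eqP. Qed.

(** The congruence on k makes a(t)(az + b)^-k and b(t)(az + b)^-k invariant under scaling (a, b), as
    [box_cvg] demands. *)
Lemma iota_expV_k c : c != 0 -> iota c * iota c ^- k = 1.
Proof.
move=> c0; have ic : iota c != 0 by rewrite fmorph_eq0.
have := iota_expV_dvd c0 dvd_pred_k.
by rewrite -{2}(subnKC k0) exprD expr1 invfM mulrA divff // mul1r.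
Qed.

Lemma dvd_pred_sub l : (q ^ l < k)%N -> (q.-1 %| k - q ^ l)%N.
Proof.
move=> lk; rewrite -eqn_mod_dvd ?(ltnW lk) // -subn1 hk eq_sym.
by rewrite eqn_mod_dvd ?card_pow_gt0 // !subn1 dvdn_pred_predX.
Qed.

Lemma goss_latsum a : a != 0 -> (G k).[uC iota nrm theta pit (embA a * z)] =
  pit ^- k * latsum iota nrm theta k (embA a * z).
Proof. by move=> a0; apply: HG => //; apply: Omega_lattice. Qed.

Lemma Eis1E i : Eis1 iota nrm theta k z i = - monic_rows z phi_l k i.
Proof.
have homog c a b j : c != 0 -> phi_l (c *: a) (c *: b) j * iota c ^- k = phi_l a b j.
  by move=> c0; rewrite /phi_l tateAZ mulrAC iota_expV_k // mul1r.
rewrite [LHS](TlimE (box_cvg Hz nrm_phi_l k0 homog)).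
suff -> : monic_axis phi_l k i = 0 by rewrite oppr0 add0r.
apply: (@TlimE _ (fun=> 0)); apply: cvgT_ext (cvgT_const (cvgC_cst 0)) => // n j.
by symmetry; apply: big1 => d _; apply: big1 => f _; rewrite /phi_l tateA0 mul0r.
Qed.

Lemma RHS1E i : RHS1 iota nrm theta pit G k z i = - pit ^- k * monic_rows z phi_l k i.
Proof.
apply: (@TlimE _ (fun j => - pit ^- k * monic_rows z phi_l k j)).
apply: cvgT_ext (cvgT_M (- pit ^- k) (monic_rows_cvg Hz nrm_phi_l k0)) => // n j.
rewrite mulr_sumr; apply: eq_bigr => d _; rewrite mulr_sumr; apply: eq_bigr => f _.
rewrite goss_latsum ?monicN_neq0 // rowlim_phi_l ?monicN_neq0 //.
by rewrite !mulNr mulrCA.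
Qed.

Lemma Eis2E i : Eis2 iota nrm theta k z i =
  - Lchi iota nrm theta k i - monic_rows z phi_r k i.
Proof.
have homog c a b j : c != 0 -> phi_r (c *: a) (c *: b) j * iota c ^- k = phi_r a b j.
  by move=> c0; rewrite /phi_r tateAZ mulrAC iota_expV_k // mul1r.
exact: (TlimE (box_cvg Hz nrm_phi_r k0 homog)).
Qed.

(** The pairs (0, b) contribute -zeta to the Eisenstein series, so adding zeta leaves only the rows
    with a != 0. *)
Lemma zetaC_GossE l : (q ^ l < k)%N ->
  zetaC iota nrm theta (k - q ^ l) + GossE iota nrm theta (k - q ^ l) z =
  - monic_rows z phi_one (k - q ^ l) 0%N.
Proof.
set m := (k - _)%N => lk; have m0 : (0 < m)%N by rewrite subn_gt0.
have homog c (a b : {poly F}) j : c != 0 ->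
    phi_one (c *: a) (c *: b) j * iota c ^- m = phi_one a b j.
  by move=> c0; rewrite /phi_one iota_expV_dvd ?mulr1 // dvd_pred_sub.
have -> : zetaC iota nrm theta m = monic_axis phi_one m 0%N.
  apply: ClimE; apply: cvgC_ext (cvgT_cvgC 0 (monic_axis_cvg nrm_phi_one m0)) => n.
  by apply: eq_bigr => d _; apply: eq_bigr => f _; rewrite mul1r.
have -> : GossE iota nrm theta m z =
    - monic_axis phi_one m 0%N - monic_rows z phi_one m 0%N.
  apply: ClimE; apply: cvgC_ext (cvgT_cvgC 0 (box_cvg Hz nrm_phi_one m0 homog)) => n.
  apply: eq_bigr => f _; apply: eq_bigr => g _.
  by case: ifP => // _; rewrite mulr1.
by rewrite addrA subrr sub0r.
Qed.

Lemma RHS2E i : RHS2 iota nrm theta pit G k z i =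
  pit ^- k * (Tmul (Tinv omega) (fun j => \sum_(l < k | (q ^ l < k)%N)
     monic_rows z phi_one (k - q ^ l) 0%N * alpha l j) i - monic_rows z phi_r k i).
Proof.
pose V l n := \sum_(d < n) \sum_(f : {ffun 'I_d -> F})
  rowlim z phi_one (k - q ^ l) (monicN f) 0%N.
have cV : cvgT (fun n => Tmul (Tinv omega) (fun j => \sum_(l < k | (q ^ l < k)%N)
     V l n * alpha l j))
   (Tmul (Tinv omega) (fun j => \sum_(l < k | (q ^ l < k)%N)
     monic_rows z phi_one (k - q ^ l) 0%N * alpha l j)).
  (* Bounded coefficients of 1/omega and of [alpha l] let the limit over a pass inside the
     product. *)
  apply: (cvgT_Tmul nrm_Tinv_omega_le); apply: cvgT_sum => l lk.
  apply: (cvgT_mull (nrm_alpha_le l)).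
  have kl : (0 < k - q ^ l)%N by rewrite subn_gt0.
  exact: (cvgT_cvgC 0 (monic_rows_cvg Hz nrm_phi_one kl)).
have cW := cvgT_M (-1) (monic_rows_cvg Hz nrm_phi_r k0).
apply: (@TlimE _ (fun i => pit ^- k * (Tmul (Tinv omega)
   (fun j => \sum_(l < k | (q ^ l < k)%N)
     monic_rows z phi_one (k - q ^ l) 0%N * alpha l j) i - monic_rows z phi_r k i))).
apply: cvgT_ext (cvgT_M (pit ^- k) (cvgT_D cV cW)) => [n j|j]; rewrite mulN1r //.
have -> : Tmul (Tinv omega) (fun j => \sum_(l < k | (q ^ l < k)%N) V l n * alpha l j) j =
   \sum_(d < n) \sum_(f : {ffun 'I_d -> F}) Tmul (Tinv omega) (fun j =>
     \sum_(l < k | (q ^ l < k)%N)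
        alpha l j * latsum iota nrm theta (k - q ^ l) (embA (monicN f) * z)) j.
  under [RHS]eq_bigr do rewrite -Tmul_sum.
  rewrite -Tmul_sum; apply: eq_Tmul => // i'.
  under [RHS]eq_bigr do rewrite exchange_big.
  rewrite exchange_big; apply: eq_bigr => l lk; rewrite /V mulr_suml.
  apply: eq_bigr => d _; rewrite mulr_suml; apply: eq_bigr => f _.
  by rewrite mulrC -(latsum_rowlim Hz) ?subn_gt0 ?monicN_neq0.
rewrite -sumrB mulr_sumr; apply: eq_bigr => d _.
rewrite -sumrB mulr_sumr; apply: eq_bigr => f _.
rewrite goss_latsum ?monicN_neq0 // rowlim_phi_r ?monicN_neq0 //.
by rewrite subKr mulrCA.
Qed.

Lemma Eis2_identity i : pit ^- k * Eis2 iota nrm theta k z i =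
  lambdak iota nrm theta pit k z i + RHS2 iota nrm theta pit G k z i.
Proof.
rewrite RHS2E Eis2E /lambdak.
(* Since [alpha l] contains pit^(q^l), the quotient by pit^k gives 1 / pit^(k - q^l): the sum in
   lambda_k is the negative of the 1/omega part of [RHS2], and the two cancel. *)
have -> : Tmul (Tinv omega) (fun i' => \sum_(l < k | (qq F ^ l < k)%N)
    (zetaC iota nrm theta (k - qq F ^ l) + GossE iota nrm theta (k - qq F ^ l) z)
       / (pit ^+ (k - qq F ^ l) * Dj F theta l) * inv_ct (theta ^+ (qq F ^ l)) i') i =
  - pit ^- k * Tmul (Tinv omega) (fun j => \sum_(l < k | (q ^ l < k)%N)
     monic_rows z phi_one (k - q ^ l) 0%N * alpha l j) i.
  rewrite -TmulZ; apply: eq_Tmul => // j; rewrite mulr_sumr; apply: eq_bigr => l lk.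
  rewrite (zetaC_GossE lk) alphaE !mulNr; congr (- _).
  have pX n : pit ^+ n != 0 by rewrite expf_neq0 ?pit_neq0.
  rewrite mulrCA -!mulrA; congr (_ * _); rewrite invfM !mulrA; congr (_ * _ * _).
  apply: (canRL (mulKf (pX k))).
  by rewrite -{1}(subnK (ltnW lk)) exprD mulrAC mulfV ?mul1r.
move: (pit ^- k) (Tmul _ _ _) => P t; ring.
Qed.

End Eisenstein.

End CarlitzExponential.

End Cinfty.

Theorem theorem3p21 (R : realType) (C : closedFieldType) (F : finFieldType)
  (iota : {rmorphism F -> C}) (nrm : C -> R) (theta : C)
  (HC : is_Cinfty iota nrm theta)
  (pit : C) (Hpit : is_carlitz_period F nrm theta pit)
  (G : nat -> {poly C}) (HG : is_goss iota nrm theta pit G)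
  (k : nat) (hk0 : (0 < k)%N) (hk : k = 1 %[mod (qq F) - 1]) :
  exists r : R, forall z : C, Omega iota nrm theta z ->
    (forall kappa : C, Kinf iota nrm theta kappa -> r <= nrm (z - kappa)) ->
    (forall i : nat,
       pit ^- k * Eis1 iota nrm theta k z i = RHS1 iota nrm theta pit G k z i) /\
    (forall i : nat,
       pit ^- k * Eis2 iota nrm theta k z i
       = lambdak iota nrm theta pit k z i + RHS2 iota nrm theta pit G k z i).
Proof.
have [r [r_root pit_cvg]] := Hpit.
(* With the bound 1, every b in A, being in K_infty, satisfies |z - b| >= 1, the input of the
   lattice estimates. *)
exists 1 => z _ Hz.
have {}Hz b : 1 <= nrm (z - embA iota theta b) by apply/Hz/Kinf_embA.
split=> i; last exact: (Eis2_identity HC r_root pit_cvg Hz hk0 hk HG).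
by rewrite (Eis1E HC Hz hk0 hk) (RHS1E HC Hz hk0 HG) mulrN mulNr.
Qed.
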